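(* Let $n\ge 1$ be an integer, and let $g_m$, $h_m$ ($m\ge 0$) be the polynomials defined in the context. For $\sigma\in[0,1]$ consider the $G$-heat equation $$\frac{\partial u}{\partial t}-\frac12\Big(\big(\tfrac{\partial^2u}{\partial x^2}\big)^{+}-\sigma^2\big(\tfrac{\partial^2u}{\partial x^2}\big)^{-}\Big)=0,\qquad u(0,x)=x^{2n+1},\qquad (t,x)\in[0,\infty)\times\mathbb{R}. \tag{$*$}$$ **(i)** For each fixed $\sigma\in(0,1)$ define $$P_n^{\sigma}(x)=\begin{cases} g_n(x)+\dfrac{k_n}{(2n)!!}\Big[h_n(x)e^{-x^2/2}-g_n(x)\displaystyle\int_x^{\infty}e^{-s^2/2}\,ds\Big], & x\ge c_n,\\[3mm] \sigma^{2n+1}g_n\big(\tfrac{x}{\sigma}\big)+\dfrac{d_n}{(2n)!!}\Big[h_n\big(\tfrac{x}{\sigma}\big)e^{-x^2/(2\sigma^2)}+g_n\big(\tfrac{x}{\sigma}\big)\displaystyle\int_{-\infty}^{x/\sigma}e^{-s^2/2}\,ds\Big], & x<c_n,\end{cases}$$ where $c_n,k_n,d_n$ are constants such that $c_n<0$ and $$h_{n-1}\big(\tfrac{c_n}{\sigma}\big)+g_{n-1}\big(\tfrac{c_n}{\sigma}\big)e^{c_n^2/(2\sigma^2)}\int_{-\infty}^{c_n/\sigma}e^{-s^2/2}\,ds=\sigma^{2n}\Big[h_{n-1}(c_n)-g_{n-1}(c_n)e^{c_n^2/2}\int_{c_n}^{\infty}e^{-s^2/2}\,ds\Big],$$ $$k_n=-\frac{(2n)!!\,g_{n-1}(c_n)}{h_{n-1}(c_n)e^{-c_n^2/2}-g_{n-1}(c_n)\int_{c_n}^{\infty}e^{-s^2/2}\,ds},\qquad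 d_n=\frac{\sigma\, g_{n-1}(c_n/\sigma)}{g_{n-1}(c_n)}\,k_n\exp\Big(\frac{1-\sigma^2}{2\sigma^2}c_n^2\Big).$$ Then $u_n^{\sigma}(t,x):=t^{n+\frac12}P_n^{\sigma}\big(\tfrac{x}{\sqrt t}\big)$ is the unique solution of $( * )$. **(ii)** For $\sigma=0$ define $$P_n(x)=\begin{cases} g_n(x)+\dfrac{k_n}{(2n)!!}\Big[h_n(x)e^{-x^2/2}-g_n(x)\displaystyle\int_x^{\infty}e^{-s^2/2}\,ds\Big], & x\ge c_n,\\[3mm] x^{2n+1}, & x<c_n,\end{cases}$$ where $c_n,k_n$ are constants such that $c_n<0$ and $$(2n-1)!=c_n^{2n}\Big[h_{n-1}(c_n)-g_{n-1}(c_n)e^{c_n^2/2}\int_{c_n}^{\infty}e^{-s^2/2}\,ds\Big],\qquad k_n=-\frac{2n}{(2n-1)!!}\,g_{n-1}(c_n)\,c_n^{2n}\,e^{c_n^2/2}.$$ Then $u_n(t,x):=t^{n+\frac12}P_n\big(\tfrac{x}{\sqrt t}\big)$ is the unique viscosity solution of $( * )$ with $\sigma=0$.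
   Context: Notation: $a^+=\max\{0,a\}$, $a^-=(-a)^+$. Double factorials: $(2m)!!=2\cdot4\cdots(2m)$, $(2m-1)!!=1\cdot3\cdots(2m-1)$, with the convention $0!=1$ and $0!!=1$. For each integer $m\ge0$, $$g_m(x)=\sum_{i=0}^{m}\frac{(2m+1)!}{(2(m-i))!!\,(2i+1)!}\,x^{2i+1},$$ $$h_m(x)=\sum_{i=0}^{m}\frac{(m+i)!\,(m-i)!}{(2(m-i))!!\,(2i)!}\left(\binom{2m+1}{0}+\cdots+\binom{2m+1}{m-i}\right)x^{2i}.$$ Solutions of the $G$-heat equation $( * )$ are understood in the viscosity sense; for $\sigma\in(0,1]$ the equation is uniformly parabolic and the solution is $C^{1,2}$. The formulas for $u_n^\sigma$ and $u_n$ are read for $t>0$, the value at $t=0$ being the initial condition $x^{2n+1}$. *)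

(* Defs.v *)
From Stdlib Require Import Reals Factorial.
From Coquelicot Require Import Coquelicot.
Open Scope R_scope.

Fixpoint double_fact (n : nat) : nat :=
  match n with
  | S (S m as p) => (S p * double_fact m)%nat
  | _ => 1%nat
  end.

Definition g (m : nat) (x : R) : R :=
  sum_f_R0 (fun i =>
    INR (fact (2 * m + 1))
      / (INR (double_fact (2 * (m - i))) * INR (fact (2 * i + 1)))
      * x ^ (2 * i + 1)) m.

(* [Binomial.C] is the binomial coefficient; a bare [C] would be Coquelicot's
   type of complex numbers. *)
Definition h (m : nat) (x : R) : R :=
  sum_f_R0 (fun i =>
    INR (fact (m + i)) * INR (fact (m - i))
      / (INR (double_fact (2 * (m - i))) * INR (fact (2 * i)))
      * sum_f_R0 (fun j => Binomial.C (2 * m + 1) j) (m - i)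
      * x ^ (2 * i)) m.

Definition upper_gauss (x : R) : R :=
  RInt_gen (fun s => exp (- s ^ 2 / 2)) (at_point x) (Rbar_locally p_infty).

Definition lower_gauss (x : R) : R :=
  RInt_gen (fun s => exp (- s ^ 2 / 2)) (Rbar_locally m_infty) (at_point x).

Definition pos_part (a : R) : R := Rmax 0 a.
Definition neg_part (a : R) : R := pos_part (- a).

Definition G (sigma a : R) : R :=
  / 2 * (pos_part a - sigma ^ 2 * neg_part a).

(* In functions of type [R -> R -> R] the first argument is the time [t] and
   the second the space variable [x]. *)
Definition dt (phi : R -> R -> R) (t x : R) : R := Derive (fun s => phi s x) t.
Definition dx (phi : R -> R -> R) (t x : R) : R := Derive (phi t) x.
Definition dxx (phi : R -> R -> R) (t x : R) : R := Derive (dx phi t) x.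

Definition uncurry2 (u : R -> R -> R) (p : R * R) : R := u (fst p) (snd p).

(* [phi] is of class C^{1,2} on (0,oo) x R; the existence clauses are needed
   because [Derive] is total. *)
Definition C12 (phi : R -> R -> R) : Prop :=
  forall t x : R, 0 < t ->
    ex_derive (fun s => phi s x) t /\
    ex_derive (phi t) x /\
    ex_derive (dx phi t) x /\
    continuous (uncurry2 phi) (t, x) /\
    continuous (uncurry2 (dt phi)) (t, x) /\
    continuous (uncurry2 (dx phi)) (t, x) /\
    continuous (uncurry2 (dxx phi)) (t, x).

Definition viscosity_subsolution (sigma : R) (u : R -> R -> R) : Prop :=
  forall (phi : R -> R -> R) (t x : R), C12 phi -> 0 < t ->
    locally (t, x)
      (fun p : R * R => u (fst p) (snd p) - phi (fst p) (snd p)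
                        <= u t x - phi t x) ->
    dt phi t x - G sigma (dxx phi t x) <= 0.

Definition viscosity_supersolution (sigma : R) (u : R -> R -> R) : Prop :=
  forall (phi : R -> R -> R) (t x : R), C12 phi -> 0 < t ->
    locally (t, x)
      (fun p : R * R => u t x - phi t x
                        <= u (fst p) (snd p) - phi (fst p) (snd p)) ->
    0 <= dt phi t x - G sigma (dxx phi t x).

(* Viscosity solutions of the Cauchy problem
   u_t - G sigma (u_xx) = 0,  u(0,x) = f x.
   Only the values u t x with 0 <= t are constrained. *)
Definition viscosity_solution (sigma : R) (f : R -> R) (u : R -> R -> R) : Prop :=
  continuous_on (fun p : R * R => 0 <= fst p) (uncurry2 u) /\
  (forall x : R, u 0 x = f x) /\
  viscosity_subsolution sigma u /\
  viscosity_supersolution sigma u.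

Definition polynomial_growth (u : R -> R -> R) : Prop :=
  forall T : R, 0 < T ->
    exists (K : R) (p : nat), forall t x : R, 0 <= t <= T ->
      Rabs (u t x) <= K * (1 + Rabs x ^ p).

(* Uniqueness is within the class of functions of polynomial growth in x,
   locally uniformly in t; without a growth condition it already fails for the
   classical heat equation. *)
Definition unique_viscosity_solution (sigma : R) (f : R -> R)
    (u : R -> R -> R) : Prop :=
  (viscosity_solution sigma f u /\ polynomial_growth u) /\
  (forall v : R -> R -> R,
     viscosity_solution sigma f v -> polynomial_growth v ->
     forall t x : R, 0 <= t -> v t x = u t x).

Definition initial_value (n : nat) (x : R) : R := x ^ (2 * n + 1).

(* Junk value for t < 0. *)
Definition self_similar (n : nat) (P : R -> R) (t x : R) : R :=
  if Rlt_dec 0 t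
  then Rpower t (INR n + / 2) * P (x / sqrt t)
  else initial_value n x.

Definition P_right (n : nat) (k x : R) : R :=
  g n x + k / INR (double_fact (2 * n))
            * (h n x * exp (- x ^ 2 / 2) - g n x * upper_gauss x).

Definition P_pos (n : nat) (sigma c k d x : R) : R :=
  if Rle_dec c x
  then P_right n k x
  else sigma ^ (2 * n + 1) * g n (x / sigma)
       + d / INR (double_fact (2 * n))
         * (h n (x / sigma) * exp (- x ^ 2 / (2 * sigma ^ 2))
            + g n (x / sigma) * lower_gauss (x / sigma)).

Definition constants_pos (n : nat) (sigma c k d : R) : Prop :=
  c < 0 /\
  h (n - 1) (c / sigma)
    + g (n - 1) (c / sigma) * exp (c ^ 2 / (2 * sigma ^ 2))
      * lower_gauss (c / sigma)
  = sigma ^ (2 * n)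
    * (h (n - 1) c - g (n - 1) c * exp (c ^ 2 / 2) * upper_gauss c) /\
  k = - (INR (double_fact (2 * n)) * g (n - 1) c
         / (h (n - 1) c * exp (- c ^ 2 / 2) - g (n - 1) c * upper_gauss c)) /\
  d = sigma * g (n - 1) (c / sigma) / g (n - 1) c * k
      * exp ((1 - sigma ^ 2) / (2 * sigma ^ 2) * c ^ 2).

Definition P_zero (n : nat) (c k x : R) : R :=
  if Rle_dec c x then P_right n k x else x ^ (2 * n + 1).

Definition constants_zero (n : nat) (c k : R) : Prop :=
  c < 0 /\
  INR (fact (2 * n - 1))
  = c ^ (2 * n)
    * (h (n - 1) c - g (n - 1) c * exp (c ^ 2 / 2) * upper_gauss c) /\
  k = - (2 * INR n / INR (double_fact (2 * n - 1)))
      * g (n - 1) c * c ^ (2 * n) * exp (c ^ 2 / 2).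

(* Main.v *)
(* The substitution u = t^(n+1/2) P(x/sqrt t) turns the equation into
   (n + 1/2) P - y P'/2 = G(P''), that is, into y'' + x y' = (2n+1) y where P is
   convex and into its rescaling by sigma where P is concave.  The linear
   equation has the solutions g_n and H_n = h_n e^(-x^2/2) - g_n (Gaussian tail);
   the second derivatives of g_n and H_n are multiples of g_(n-1) and H_(n-1),
   and H_n > 0 because it is convex and decays.  The constants are those for
   which P'' vanishes at c from both sides (only from the right if sigma = 0).
   The Wronskian of g_(n-1) and H_(n-1) is a multiple of e^(-x^2/2); it gives the
   sign of P'' on either side of c, and shows that the equation for c means that
   P' is continuous.  For sigma > 0 the solution is therefore of class C^{1,2};
   for sigma = 0 it is touched at the interface from below by x^(2n+1) and from
   above by the continuation of the right branch.

   Such touching classical sub- and supersolutions can serve as test functions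
   against an arbitrary viscosity solution v.  If v - u exceeds the barrier
   K e^(lambda (t - T - 1)) (1 + x^2)^(p+1) at some time before T, then the
   difference has an interior maximum, because at time T + 1 the barrier
   dominates the growth bound; this contradicts the equation for large lambda,
   and the barrier tends to 0 on [0, T] as lambda grows. *)

Require Import Defs.
From Stdlib Require Import Reals Factorial Lra Lia Psatz ClassicalEpsilon.
From Coquelicot Require Import Coquelicot.
Open Scope R_scope.

(** * The polynomials g and h *)

(** With n = m + 1, the constants become transparent through the quotient M_m = H_m / e^(-x^2/2),
    called [mills] below. The brackets in the equations for c are values of M_m, and these equations
    read M_m(-c/sigma) = sigma^(2n) M_m(c) and (2n-1)! = c^(2n) M_m(c). The slope of the right
    branch at c is a Wronskian divided by H_m(c), hence a multiple of 1/M_m(c); this is why a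
    condition on M_m is a condition on slopes. Solvability with c < 0 follows from the intermediate
    value theorem, because M_m decreases and grows at -oo at least like e^(x^2/2).

    All properties of H_n rest on two identities for the coefficients of h. One relates neighbouring
    powers of x and makes H_n a solution of the linear equation; the other relates n to n + 1 and
    makes H_(n+1)'' a multiple of H_n. The second lets the sign of H_n propagate by induction on n.
    Coefficient lemmas are stated with the degree in the form i + k or S (i + k), which removes the
    truncated subtractions from the factorials. *)

Definition gcoef (n i : nat) : R :=
  INR (fact (2 * n + 1))
    / (INR (double_fact (2 * (n - i))) * INR (fact (2 * i + 1))).

Definition binom_sum (n k : nat) : R :=
  sum_f_R0 (fun j => Binomial.C (2 * n + 1) j) k.

Definition hcoef (n i : nat) : R :=
  INR (fact (n + i)) * INR (fact (n - i))
    / (INR (double_fact (2 * (n - i))) * INR (fact (2 * i)))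
    * binom_sum n (n - i).

Lemma double_fact_even (k : nat) :
  INR (double_fact (2 * k)) = 2 ^ k * INR (fact k).
Proof.
  induction k as [|k IH]; [simpl; lra|].
  replace (2 * S k)%nat with (S (S (2 * k))) by lia.
  change (double_fact (S (S (2 * k))))
    with (S (S (2 * k)) * double_fact (2 * k))%nat.
  rewrite mult_INR, IH, fact_simpl, mult_INR, !S_INR, mult_INR.
  simpl; ring.
Qed.

Lemma INR_fact_S (k : nat) : INR (fact (S k)) = (INR k + 1) * INR (fact k).
Proof. now rewrite fact_simpl, mult_INR, S_INR. Qed.

(** Comparison of the coefficients of x^(2i+1) in g'' + x g' = (2n+1) g for n = S (i + k), where n -
    i = k + 1. *)
Lemma gcoef_succ (i k : nat) :
  (2 * INR i + 3) * (2 * INR i + 2) * gcoef (S (i + k)) (S i)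
  = 2 * (INR k + 1) * gcoef (S (i + k)) i.
Proof.
  unfold gcoef.
  replace (S (i + k) - S i)%nat with k by lia.
  replace (S (i + k) - i)%nat with (S k) by lia.
  replace (2 * S i + 1)%nat with (S (S (2 * i + 1))) by lia.
  rewrite !double_fact_even, !INR_fact_S, !S_INR, !plus_INR, !mult_INR.
  simpl (INR 1); simpl (INR 2); simpl pow.
  pose proof (INR_fact_neq_0 (2 * i + 1)). pose proof (INR_fact_neq_0 k).
  pose proof (pow_nonzero 2 k ltac:(lra)).
  pose proof (pos_INR i). pose proof (pos_INR k).
  field; repeat split; try assumption; nra.
Qed.

Lemma gcoef_diag (n : nat) : gcoef n n = 1.
Proof.
  unfold gcoef. rewrite Nat.sub_diag. simpl (double_fact (2 * 0)).
  simpl (INR 1). field. apply INR_fact_neq_0.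
Qed.

(** Coefficient form of the identity that g_(n+1)'' is (2n+3)(2n+2) g_n. *)
Lemma gcoef_shift (i k : nat) :
  (2 * INR i + 3) * (2 * INR i + 2) * gcoef (S (i + k)) (S i)
  = (2 * INR (i + k) + 3) * (2 * INR (i + k) + 2) * gcoef (i + k) i.
Proof.
  unfold gcoef.
  replace (S (i + k) - S i)%nat with k by lia.
  replace (i + k - i)%nat with k by lia.
  replace (2 * S i + 1)%nat with (S (S (2 * i + 1))) by lia.
  replace (2 * S (i + k) + 1)%nat with (S (S (2 * (i + k) + 1))) by lia.
  rewrite !double_fact_even, !INR_fact_S, !S_INR, !plus_INR, !mult_INR, !plus_INR.
  simpl (INR 1); simpl (INR 2).
  pose proof (INR_fact_neq_0 (2 * i + 1)). pose proof (INR_fact_neq_0 k).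
  pose proof (pow_nonzero 2 k ltac:(lra)).
  pose proof (pos_INR i). pose proof (pos_INR k).
  field; repeat split; try assumption; nra.
Qed.

Lemma gcoef_pos (n i : nat) : 0 < gcoef n i.
Proof.
  unfold gcoef. rewrite double_fact_even.
  apply Rdiv_lt_0_compat; [apply INR_fact_lt_0|].
  repeat apply Rmult_lt_0_compat; try apply INR_fact_lt_0.
  apply pow_lt; lra.
Qed.

Lemma hcoef_add (i k : nat) :
  hcoef (i + k) i
  = INR (fact (i + k + i)) / (2 ^ k * INR (fact (2 * i))) * binom_sum (i + k) k.
Proof.
  unfold hcoef. replace (i + k - i)%nat with k by lia.
  rewrite double_fact_even.
  pose proof (INR_fact_neq_0 (2 * i)). pose proof (INR_fact_neq_0 k).
  pose proof (pow_nonzero 2 k ltac:(lra)).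
  field; repeat split; assumption.
Qed.

Lemma hcoef_diag (n : nat) : hcoef n n = 1.
Proof.
  unfold hcoef. rewrite Nat.sub_diag. simpl (double_fact (2 * 0)).
  unfold binom_sum, Binomial.C. simpl sum_f_R0. simpl (fact 0).
  replace (n + n)%nat with (2 * n)%nat by lia. rewrite Nat.sub_0_r.
  simpl (INR 1).
  pose proof (INR_fact_neq_0 (2 * n)). pose proof (INR_fact_neq_0 (2 * n + 1)).
  field; split; assumption.
Qed.

(** Comparison of the coefficients of x^(2i) in [h_ode]. The partial binomial sums at i and i + 1
    differ by a single binomial coefficient, and the term in [gcoef] is what compensates it. *)
Lemma hcoef_succ (i k : nat) :
  (2 * INR i + 2) * (2 * INR i + 1) * hcoef (S (i + k)) (S i)
  - (2 * INR i + 2 * INR (S (i + k)) + 2) * hcoef (S (i + k)) i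
  + 2 * (2 * INR i + 1) * gcoef (S (i + k)) i = 0.
Proof.
  change (S (i + k)) with (S i + k)%nat at 1. rewrite hcoef_add.
  replace (S (i + k)) with (i + S k)%nat by lia. rewrite hcoef_add.
  replace (S i + k)%nat with (i + S k)%nat by lia.
  unfold binom_sum at 2. rewrite tech5. fold (binom_sum (i + S k) k).
  unfold gcoef, Binomial.C.
  replace (i + S k - i)%nat with (S k) by lia.
  replace (2 * (i + S k) + 1 - S k)%nat with (S (i + S k + i)) by lia.
  rewrite double_fact_even.
  replace (i + S k + S i)%nat with (S (i + S k + i)) by lia.
  replace (2 * S i)%nat with (S (S (2 * i))) by lia.
  replace (2 * i + 1)%nat with (S (2 * i)) by lia.
  rewrite (INR_fact_S (i + S k + i)), !(INR_fact_S (S (2 * i))), !(INR_fact_S (2 * i)),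
    !(INR_fact_S k).
  rewrite !plus_INR, !S_INR, !mult_INR.
  simpl (INR 2); simpl pow.
  pose proof (INR_fact_neq_0 (2 * i)). pose proof (INR_fact_neq_0 k).
  pose proof (INR_fact_neq_0 (i + S k + i)).
  pose proof (pow_nonzero 2 k ltac:(lra)).
  pose proof (pos_INR i). pose proof (pos_INR k).
  field; repeat split; try assumption; nra.
Qed.

(** Pascal's rule applied twice gives the weights 1, 2, 1. After summation every coefficient is
    counted four times, except near the upper end of the sum, which leaves the two boundary
    terms. *)
Lemma binom_sum_succ (n k : nat) : (k < 2 * n + 1)%nat ->
  binom_sum (S n) (S k)
  = 4 * binom_sum n k + Binomial.C (2 * n + 1) (S k) - Binomial.C (2 * n + 1) k.
Proof.
  assert (E : forall j, (S j < 2 * n + 1)%nat ->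
     Binomial.C (2 * S n + 1) (S (S j)) = Binomial.C (2 * n + 1) (S (S j))
       + 2 * Binomial.C (2 * n + 1) (S j) + Binomial.C (2 * n + 1) j).
  { intros j Hj. replace (2 * S n + 1)%nat with (S (S (2 * n + 1))) by lia.
    rewrite <- !pascal by lia. ring. }
  unfold binom_sum.
  induction k as [|k IH]; intros Hk.
  - cbn [sum_f_R0]. replace (2 * S n + 1)%nat with (S (S (2 * n + 1))) by lia.
    rewrite <- (pascal (S (2 * n + 1)) 0), <- (pascal (2 * n + 1) 0) by lia.
    unfold Binomial.C. rewrite !Nat.sub_0_r.
    pose proof (INR_fact_neq_0 (2 * n + 1)).
    pose proof (INR_fact_neq_0 (S (2 * n + 1))).
    pose proof (INR_fact_neq_0 (S (S (2 * n + 1)))).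
    pose proof (INR_fact_neq_0 (2 * n + 1 - 1)).
    simpl (fact 0); simpl (INR 1). simpl (fact 1); simpl (INR 1). field. repeat split;
      assumption.
  - rewrite tech5, IH, E by lia. rewrite (tech5 _ k). ring.
Qed.

(** The factor 4 of [binom_sum_succ] times the ratio (n + i)/2 of the prefactors gives 2n + 2i; the
    two boundary binomials combine into the multiple of [gcoef] on the right. *)
Lemma hcoef_degree_succ (i k : nat) :
  let n := S (i + k) in
  2 * INR n * (2 * INR n + 1) * (hcoef n i - (2 * INR n + 2 * INR i) * hcoef (i + k) i)
  = (2 * INR i + 1) * (2 * INR i) * gcoef n i.
Proof.
  intros n; subst n. rewrite (hcoef_add i k).
  replace (S (i + k)) with (i + S k)%nat by lia. rewrite hcoef_add.
  replace (binom_sum (i + S k) (S k)) with (binom_sum (S (i + k)) (S k))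
    by (f_equal; lia).
  rewrite binom_sum_succ by lia.
  unfold gcoef, Binomial.C.
  replace (i + S k - i)%nat with (S k) by lia.
  replace (2 * (i + k) + 1 - k)%nat with (S (i + k + i)) by lia.
  replace (2 * (i + k) + 1 - S k)%nat with (i + k + i)%nat by lia.
  rewrite double_fact_even.
  replace (i + S k + i)%nat with (S (i + k + i)) by lia.
  replace (2 * i + 1)%nat with (S (2 * i)) by lia.
  replace (2 * (i + S k) + 1)%nat with (S (S (2 * (i + k) + 1))) by lia.
  rewrite (INR_fact_S (i + k + i)), !(INR_fact_S (S (2 * (i + k) + 1))),
    !(INR_fact_S (2 * (i + k) + 1)), !(INR_fact_S (2 * i)), !(INR_fact_S k).
  rewrite !S_INR, !plus_INR, !mult_INR, !plus_INR, !S_INR.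
  simpl (INR 2); simpl (INR 1); simpl (INR 0); simpl pow.
  pose proof (INR_fact_neq_0 (2 * i)). pose proof (INR_fact_neq_0 k).
  pose proof (INR_fact_neq_0 (i + k + i)).
  pose proof (pow_nonzero 2 k ltac:(lra)).
  pose proof (pos_INR i). pose proof (pos_INR k).
  field; repeat split; try assumption; nra.
Qed.

Definition dg (n : nat) (x : R) : R :=
  sum_f_R0 (fun i => gcoef n i * INR (2 * i + 1) * x ^ (2 * i)) n.
(** Here and in [dh], [ddh] the exponents are truncated at i = 0, where the factor [INR (2 * i)]
    makes the term vanish. *)
Definition ddg (n : nat) (x : R) : R :=
  sum_f_R0 (fun i => gcoef n i * INR (2 * i + 1) * INR (2 * i)
                     * x ^ (2 * i - 1)) n.
Definition dh (n : nat) (x : R) : R :=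
  sum_f_R0 (fun i => hcoef n i * INR (2 * i) * x ^ (2 * i - 1)) n.
Definition ddh (n : nat) (x : R) : R :=
  sum_f_R0 (fun i => hcoef n i * INR (2 * i) * INR (2 * i - 1)
                     * x ^ (2 * i - 2)) n.

Lemma g_coef (n : nat) (x : R) :
  g n x = sum_f_R0 (fun i => gcoef n i * x ^ (2 * i + 1)) n.
Proof. reflexivity. Qed.

Lemma h_coef (n : nat) (x : R) :
  h n x = sum_f_R0 (fun i => hcoef n i * x ^ (2 * i)) n.
Proof. reflexivity. Qed.

Lemma is_derive_sum_f_R0 (a : nat -> R) (e : nat -> nat) (n : nat) (x : R) :
  is_derive (fun y => sum_f_R0 (fun i => a i * y ^ e i) n) x
    (sum_f_R0 (fun i => a i * INR (e i) * x ^ pred (e i)) n).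
Proof.
  induction n as [|n IH]; simpl; [|apply (is_derive_plus (V := R_NormedModule));
    [exact IH|]];
    auto_derive; trivial; ring.
Qed.

Lemma is_derive_g (n : nat) (x : R) : is_derive (g n) x (dg n x).
Proof.
  eapply is_derive_ext; [intros t; symmetry; apply g_coef|].
  unfold dg. erewrite sum_eq; [apply is_derive_sum_f_R0|].
  intros i _; cbv beta. do 2 f_equal; lia.
Qed.

Lemma is_derive_dg (n : nat) (x : R) : is_derive (dg n) x (ddg n x).
Proof.
  unfold ddg. erewrite sum_eq; [apply is_derive_sum_f_R0|].
  intros i _; cbv beta. do 2 f_equal; lia.
Qed.

Lemma is_derive_h (n : nat) (x : R) : is_derive (h n) x (dh n x).
Proof.
  eapply is_derive_ext; [intros t; symmetry; apply h_coef|].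
  unfold dh. erewrite sum_eq; [apply is_derive_sum_f_R0|].
  intros i _; cbv beta. do 2 f_equal; lia.
Qed.

Lemma is_derive_dh (n : nat) (x : R) : is_derive (dh n) x (ddh n x).
Proof.
  unfold ddh. erewrite sum_eq; [apply is_derive_sum_f_R0|].
  intros i _; cbv beta. do 2 f_equal; lia.
Qed.

Lemma ddg_g (n : nat) (x : R) :
  ddg (S n) x = (2 * INR n + 3) * (2 * INR n + 2) * g n x.
Proof.
  rewrite g_coef. unfold ddg.
  rewrite decomp_sum by lia. simpl (pred (S n)).
  rewrite scal_sum. simpl (INR (2 * 0)). rewrite Rmult_0_r, Rmult_0_l, Rplus_0_l.
  apply sum_eq. intros i Hi.
  destruct (Nat.le_exists_sub i n Hi) as [k [Ek _]].
  replace n with (i + k)%nat by lia.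
  replace (2 * S i - 1)%nat with (2 * i + 1)%nat by lia.
  pose proof (gcoef_shift i k) as E.
  rewrite !plus_INR, !mult_INR, S_INR, ?plus_INR in *. simpl (INR 2). simpl (INR 1).
  rewrite ?S_INR, ?mult_INR. simpl (INR 2).
  transitivity (((2 * INR i + 3) * (2 * INR i + 2) * gcoef (S (i + k)) (S i)) * x ^
    (2 * i + 1)); [|rewrite E]; ring.
Qed.

(* The partial sums of the left-hand side telescope to the single term
   [2 (N - n) gcoef n N x^(2N+1)], which vanishes for [N = n]. *)
Lemma g_ode (n : nat) (x : R) :
  ddg n x + x * dg n x - (2 * INR n + 1) * g n x = 0.
Proof.
  assert (T : forall N, (N <= n)%nat ->
    sum_f_R0 (fun i => gcoef n i * INR (2 * i + 1) * INR (2 * i) * x ^ (2 * i - 1)) N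
    + x * sum_f_R0 (fun i => gcoef n i * INR (2 * i + 1) * x ^ (2 * i)) N
    - (2 * INR n + 1) * sum_f_R0 (fun i => gcoef n i * x ^ (2 * i + 1)) N
    = 2 * (INR N - INR n) * gcoef n N * x ^ (2 * N + 1)).
  { induction N as [|N IH]; intros HN.
    - simpl. ring.
    - specialize (IH ltac:(lia)). rewrite !tech5.
      destruct (Nat.le_exists_sub (S N) n HN) as [k [Ek _]].
      assert (En : n = S (N + k)) by lia. clear Ek. subst n.
      pose proof (gcoef_succ N k) as E.
      replace (2 * S N - 1)%nat with (2 * N + 1)%nat by lia.
      replace (2 * S N + 1)%nat with (S (S (2 * N + 1))) by lia.
      replace (2 * S N)%nat with (S (2 * N + 1)) by lia.
      rewrite !S_INR, !plus_INR, mult_INR in *. simpl (INR 2) in *. simpl (INR 1) in *.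
      rewrite <- ?tech_pow_Rmult in *.
      replace (2 * (INR N - (INR N + INR k + 1)) * gcoef (S (N + k)) N)
         with (- (2 * (INR k + 1) * gcoef (S (N + k)) N)) in IH by ring.
      rewrite <- E in IH.
      match goal with |- ?A1 + _ + _ * (?A2 + _) - _ * (?A3 + _) = _ =>
        set (a1 := A1) in *; set (a2 := A2) in *; set (a3 := A3) in * end.
      assert (Ha : a1 = - (2 * INR N + 3) * (2 * INR N + 2) * gcoef (S (N + k))
        (S N) * x ^ (2 * N + 1) - x * a2 + (2 * (INR N + INR k + 1) + 1) * a3) by lra.
      rewrite Ha. ring. }
  specialize (T n (le_n n)).
  unfold ddg, dg. rewrite g_coef, T. ring.
Qed.

(** This is what remains of the linear equation for h e^(-x^2/2) - g (tail) once the tail terms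
    cancel by [g_ode]. The partial sums telescope; the boundary term vanishes at N = n because both
    leading coefficients are 1 and 2(2n+1) = 2n + 2n + 2. *)
Lemma h_ode (n : nat) (x : R) :
  ddh n x - x * dh n x - (2 * INR n + 2) * h n x + 2 * dg n x = 0.
Proof.
  assert (T : forall N, (N <= n)%nat ->
    sum_f_R0 (fun i => hcoef n i * INR (2 * i) * INR (2 * i - 1) * x ^ (2 * i - 2)) N
    - x * sum_f_R0 (fun i => hcoef n i * INR (2 * i) * x ^ (2 * i - 1)) N
    - (2 * INR n + 2) * sum_f_R0 (fun i => hcoef n i * x ^ (2 * i)) N
    + 2 * sum_f_R0 (fun i => gcoef n i * INR (2 * i + 1) * x ^ (2 * i)) N
    = (2 * (2 * INR N + 1) * gcoef n N
       - (2 * INR N + 2 * INR n + 2) * hcoef n N) * x ^ (2 * N)).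
  { induction N as [|N IH]; intros HN.
    - simpl. ring.
    - specialize (IH ltac:(lia)). rewrite !tech5.
      destruct (Nat.le_exists_sub (S N) n HN) as [k [Ek _]].
      assert (En : n = S (N + k)) by lia. clear Ek. subst n.
      pose proof (hcoef_succ N k) as E.
      replace (2 * S N - 1)%nat with (S (2 * N)) by lia.
      replace (2 * S N - 2)%nat with (2 * N)%nat by lia.
      replace (2 * S N + 1)%nat with (S (S (S (2 * N)))) by lia.
      replace (2 * S N)%nat with (S (S (2 * N))) by lia.
      rewrite !S_INR, !plus_INR, mult_INR in *. simpl (INR 2) in *. simpl (INR 1) in *.
      rewrite <- ?tech_pow_Rmult in *.
      match goal with |- ?A1 + _ - _ * (?A2 + _) - _ * (?A3 + _) + 2 * (?A4 + _) = _ =>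
        set (a1 := A1) in *; set (a2 := A2) in *; set (a3 := A3) in *;
          set (a4 := A4) in * end.
      replace (2 * (2 * INR N + 1) * gcoef (S (N + k)) N - (2 * INR N + 2 *
        (INR N + INR k + 1) + 2) * hcoef (S (N + k)) N)
        with (- ((2 * INR N + 2) * (2 * INR N + 1) * hcoef (S (N + k)) (S N))) in IH
          by lra.
      match type of IH with _ = ?rhs =>
      assert (Ha : a1 = rhs + x * a2 + (2 * (INR N + INR k + 1) + 2) * a3 - 2 * a4)
        by lra end.
      rewrite Ha. ring. }
  specialize (T n (le_n n)).
  unfold ddh, dh, dg. rewrite h_coef, T, gcoef_diag, hcoef_diag. ring.
Qed.

(* Telescoping as in [g_ode]. *)
Lemma h_degree_succ (n : nat) (x : R) :
  (2 * INR n + 3) * h (S n) x - x * (dh (S n) x - x * h (S n) x + g (S n) x)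
  = (2 * INR n + 2) * (2 * INR n + 3) * h n x.
Proof.
  assert (T : forall N, (N <= n)%nat ->
    (2 * INR n + 3) * sum_f_R0 (fun i => hcoef (S n) i * x ^ (2 * i)) N
    - x * (sum_f_R0 (fun i => hcoef (S n) i * INR (2 * i) * x ^ (2 * i - 1)) N
       - x * sum_f_R0 (fun i => hcoef (S n) i * x ^ (2 * i)) N
       + sum_f_R0 (fun i => gcoef (S n) i * x ^ (2 * i + 1)) N)
    - (2 * INR n + 2) * (2 * INR n + 3) * sum_f_R0 (fun i => hcoef n i * x ^ (2 * i)) N
    = (hcoef (S n) N - gcoef (S n) N) * x ^ (2 * N + 2)).
  { assert (Z : forall i, (i <= n)%nat ->
      (2 * INR n + 2) * (2 * INR n + 3) * (hcoef (S n) i -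
        (2 * INR n + 2 + 2 * INR i) * hcoef n i)
      = (2 * INR i + 1) * (2 * INR i) * gcoef (S n) i).
    { intros i Hi. destruct (Nat.le_exists_sub i n Hi) as [k [Ek _]].
      replace n with (i + k)%nat by lia.
      pose proof (hcoef_degree_succ i k) as E. cbv zeta in E.
      rewrite S_INR in E. rewrite <- E. ring. }
    induction N as [|N IH]; intros HN.
    - pose proof (Z 0%nat HN) as E. simpl (INR 0) in E. simpl.
      pose proof (pos_INR n).
      assert (E' : hcoef (S n) 0 = (2 * INR n + 2) * hcoef n 0).
      { assert ((2 * INR n + 2) * (2 * INR n + 3) * (hcoef (S n) 0 -
          (2 * INR n + 2) * hcoef n 0) = 0) by lra.
        apply Rmult_integral in H0. destruct H0; nra. }
      rewrite E'. ring.
    - specialize (IH ltac:(lia)). rewrite !tech5.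
      pose proof (Z (S N) HN) as E1.
      destruct (Nat.le_exists_sub (S N) n HN) as [k [Ek _]].
      assert (En : n = (N + S k)%nat) by lia. clear Ek.
      pose proof (hcoef_succ N (S k)) as E2.
      pose proof (gcoef_succ N (S k)) as E3.
      rewrite <- En in E2, E3.
      assert (E4 : INR n = INR N + INR k + 1) by (rewrite En, plus_INR, S_INR; ring).
      clear En HN Z.
      replace (2 * S N - 1)%nat with (2 * N + 1)%nat by lia.
      replace (2 * S N + 2)%nat with (S (S (2 * N + 2))) by lia.
      replace (2 * S N + 1)%nat with (S (2 * N + 2)) by lia.
      replace (2 * N + 2)%nat with (S (2 * N + 1)) in * by lia.
      replace (2 * S N)%nat with (S (2 * N + 1)) by lia.
      rewrite !S_INR, !plus_INR, mult_INR in *. simpl (INR 2) in *. simpl (INR 1) in *.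
      rewrite <- ?tech_pow_Rmult in *.
      match goal with |- _ * (?A1 + _) - _ * (?A2 + _ - _ + (?A3 + _)) - _ *
        (?A4 + _) = _ =>
        set (a1 := A1) in *; set (a2 := A2) in *; set (a3 := A3) in *;
          set (a4 := A4) in * end.
      (* The factor 2n + 2N + 4 occurs in [E1] at [hcoef n (S N)] and in [E2] at [hcoef (S n) N];
         multiplied by it, the identity is a combination of [E1], [E2] and [E3]. *)
      assert (K : (2 * INR n + 3 - (2 * INR N + 2)) * hcoef (S n) (S N)
         + hcoef (S n) N - gcoef (S n) N
         = (2 * INR n + 2) * (2 * INR n + 3) * hcoef n (S N)).
      { pose proof (pos_INR n). pose proof (pos_INR N).
        apply (Rmult_eq_reg_l (2 * INR n + 2 * INR N + 4)); [|lra].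
        rewrite E4 in *. clear IH. nra. }
      match type of IH with ?lhs = ?rhs =>
        transitivity (lhs + ((2 * INR n + 3 - (2 * INR N + 2)) * hcoef (S n) (S N) -
          (2 * INR n + 2) * (2 * INR n + 3) * hcoef n (S N)) * (x * x ^ (2 * N + 1)) +
            (hcoef (S n) (S N) - gcoef (S n) (S N)) * (x * (x * (x * x ^
              (2 * N + 1))))); [ring|rewrite IH] end.
      rewrite <- K. ring. }
  specialize (T n (le_n n)).
  unfold dh. rewrite !h_coef, g_coef, !tech5.
  rewrite !gcoef_diag, !hcoef_diag.
  pose proof (hcoef_succ n 0) as E2. pose proof (gcoef_succ n 0) as E3.
  rewrite Nat.add_0_r in *. rewrite hcoef_diag in E2. rewrite gcoef_diag in E3.
  replace (2 * S n - 1)%nat with (S (2 * n)) by lia.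
  replace (2 * S n + 1)%nat with (S (S (S (2 * n)))) by lia.
  replace (2 * n + 2)%nat with (S (S (2 * n))) in * by lia.
  replace (2 * S n)%nat with (S (S (2 * n))) by lia.
  rewrite !S_INR, !mult_INR in *. simpl (INR 2) in *. simpl (INR 0) in *.
  rewrite <- ?tech_pow_Rmult in *.
  match goal with |- _ * (?A1 + _) - _ * (?A2 + _ - _ + (?A3 + _)) = _ * ?A4 =>
    set (a1 := A1) in *; set (a2 := A2) in *; set (a3 := A3) in *;
      set (a4 := A4) in * end.
  (* The top terms of degree S n, which [T] does not contain, contribute x^(2n+2) in total; the
     boundary term of [T] at N = n cancels it. *)
  assert (K : hcoef (S n) n - gcoef (S n) n = -1).
  { pose proof (pos_INR n).
    apply (Rmult_eq_reg_l (4 * INR n + 4)); [|lra]. lra. }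
  rewrite K in T. lra.
Qed.

Definition gauss (s : R) : R := exp (- s ^ 2 / 2).
Definition gauss_int (x : R) : R := RInt gauss 0 x.

(** * Gaussian tails *)

Lemma exp_le_compat (a b : R) : a <= b -> exp a <= exp b.
Proof.
  intros [H| ->]; [apply Rlt_le, exp_increasing, H|apply Rle_refl].
Qed.

Lemma gauss_pos (x : R) : 0 < gauss x.
Proof. apply exp_pos. Qed.

Lemma is_derive_gauss (x : R) : is_derive gauss x (- x * gauss x).
Proof. unfold gauss. auto_derive; trivial. simpl. unfold Rdiv. rewrite !Rmult_1_r.
  set (e := exp _). field. Qed.

Lemma continuous_gauss (x : R) : continuous gauss x.
Proof.
  apply (ex_derive_continuous (V := R_NormedModule)).
  eexists; apply is_derive_gauss.
Qed.

(** Follows from (s - 1)^2 >= 0. The majorant has an elementary primitive, so it also bounds the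
    tail integral. *)
Lemma gauss_le_exp (s : R) : gauss s <= exp (/ 2 - s).
Proof. apply exp_le_compat. pose proof (pow2_ge_0 (s - 1)). lra. Qed.

Lemma ex_RInt_gauss (a b : R) : ex_RInt gauss a b.
Proof.
  apply (ex_RInt_continuous (V := R_CompleteNormedModule)).
  intros; apply continuous_gauss.
Qed.

Lemma is_derive_gauss_int (x : R) : is_derive gauss_int x (gauss x).
Proof.
  apply (is_derive_RInt (V := R_CompleteNormedModule) gauss gauss_int 0).
  - exists (mkposreal 1 Rlt_0_1). intros y _.
    apply (RInt_correct (V := R_CompleteNormedModule)), ex_RInt_gauss.
  - apply continuous_gauss.
Qed.

Lemma is_RInt_gauss (a b : R) : is_RInt gauss a b (gauss_int b - gauss_int a).
Proof.
  apply (is_RInt_derive (V := R_CompleteNormedModule) gauss_int gauss).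
  - intros; apply is_derive_gauss_int.
  - intros; apply continuous_gauss.
Qed.

Lemma gauss_int_diff_bounds (a b : R) : a <= b ->
  0 <= gauss_int b - gauss_int a <= exp (/ 2 - a) - exp (/ 2 - b).
Proof.
  intros Hab. split.
  - apply (is_RInt_ge_0 gauss a b); [exact Hab|apply is_RInt_gauss|].
    intros; apply Rlt_le, gauss_pos.
  - apply (is_RInt_le gauss (fun s => exp (/ 2 - s)) a b);
      [exact Hab|apply is_RInt_gauss| |].
    + replace (exp (/ 2 - a) - exp (/ 2 - b))
        with (- exp (/ 2 - b) - - exp (/ 2 - a)) by ring.
      apply (is_RInt_derive (V := R_CompleteNormedModule) (fun s => - exp (/ 2 - s))).
      * intros; auto_derive; trivial; unfold Rminus; ring.
      * intros. apply (ex_derive_continuous (V := R_NormedModule)). auto_derive; trivial.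
    + intros; apply gauss_le_exp.
Qed.

Lemma gauss_int_odd (x : R) : gauss_int (- x) = - gauss_int x.
Proof.
  assert (D : forall y, is_derive (fun y => gauss_int (- y) + gauss_int y) y 0).
  { intros y. replace 0 with (- 1 * gauss (- y) + gauss y)
      by (unfold gauss; replace ((- y) ^ 2) with (y ^ 2) by ring; ring).
    apply (is_derive_plus (V := R_NormedModule) (fun y => gauss_int (- y))).
    - apply (is_derive_comp (V := R_NormedModule) gauss_int Ropp).
      + apply is_derive_gauss_int.
      + auto_derive; trivial.
    - apply is_derive_gauss_int. }
  destruct (MVT_gen (fun y => gauss_int (- y) + gauss_int y) 0 x (fun _ => 0))
    as [z [_ Hz]].
  - intros; apply D.
  - intros y _. apply derivable_continuous_pt. exists 0.
    apply is_derive_Reals, D.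
  - assert (E0 : gauss_int 0 = 0) by (apply (RInt_point (V := R_CompleteNormedModule))).
    rewrite Ropp_0, E0 in Hz. lra.
Qed.

(** The primitive is monotone and, by the exponential majorant, bounded above; its supremum is the
    limit. *)
Lemma gauss_int_limit :
  exists L, filterlim gauss_int (Rbar_locally p_infty) (locally L).
Proof.
  assert (mono : forall a b, a <= b -> gauss_int a <= gauss_int b)
    by (intros a b H; pose proof (gauss_int_diff_bounds a b H); lra).
  assert (E0 : gauss_int 0 = 0) by (apply (RInt_point (V := R_CompleteNormedModule))).
  destruct (completeness (fun y => exists x, y = gauss_int x)) as [L [ub lub]].
  - exists (exp (/ 2)). intros y [x ->].
    destruct (Rle_dec 0 x) as [Hx|Hx].
    + pose proof (gauss_int_diff_bounds 0 x Hx) as [_ H].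
      pose proof (exp_pos (/ 2 - x)). rewrite Rminus_0_r in H. lra.
    + pose proof (mono x 0 ltac:(lra)). pose proof (exp_pos (/ 2)). lra.
  - exists (gauss_int 0). now exists 0.
  - exists L. apply filterlim_locally. intros eps.
    assert (exists x0, L - eps < gauss_int x0) as [x0 Hx0].
    { destruct (Classical_Prop.classic (exists x0, L - eps < gauss_int x0)) as [H|H];
        [exact H|exfalso].
      assert (is_upper_bound (fun y => exists x, y = gauss_int x) (L - eps)) as B.
      { intros y [x ->]. apply Rnot_lt_le. intros C. apply H. now exists x. }
      apply lub in B. pose proof (cond_pos eps). lra. }
    exists x0. intros x Hx. apply Rabs_def1.
    + assert (gauss_int x <= L) by (apply ub; now exists x).
      change (gauss_int x - L < eps). pose proof (cond_pos eps). lra.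
    + pose proof (mono x0 x ltac:(lra)).
      change (- eps < gauss_int x - L). lra.
Qed.

(** Both improper integrals are reduced to the primitive [gauss_int]; one constant L serves for both
    ends because [gauss_int] is odd. *)
Lemma gauss_tails :
  exists L, forall x, upper_gauss x = L - gauss_int x
                      /\ lower_gauss x = L + gauss_int x
                      /\ 0 <= L - gauss_int x <= exp (/ 2 - x).
Proof.
  destruct gauss_int_limit as [L HL]. exists L. intros x. split; [|split].
  - apply (is_RInt_gen_unique (V := R_CompleteNormedModule)).
    intros P HP.
    apply (Filter_prod _ _ _ (eq x) (fun b => P (gauss_int b - gauss_int x))).
    + reflexivity.
    + apply (filterlim_comp _ _ _ gauss_int (fun z => z - gauss_int x)
               _ (locally L) (locally (L - gauss_int x)) HL); [|exact HP].
      apply (ex_derive_continuous (V := R_NormedModule) (fun z => z - gauss_int x)).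
      auto_derive; trivial.
    + intros a b <- Hb. exists (gauss_int b - gauss_int x).
      split; [apply is_RInt_gauss|exact Hb].
  - apply (is_RInt_gen_unique (V := R_CompleteNormedModule)).
    intros P HP.
    apply (Filter_prod _ _ _ (fun a => P (gauss_int x - gauss_int a)) (eq x)).
    + assert (F : filterlim (fun a => gauss_int x - gauss_int a)
                    (Rbar_locally m_infty) (locally (L + gauss_int x))).
      { apply (filterlim_ext (fun a => gauss_int x + gauss_int (- a))).
        { intros a. rewrite gauss_int_odd. ring. }
        apply (filterlim_comp _ _ _ (fun a => gauss_int (- a)) (fun z => gauss_int x + z)
               _ (locally L)).
        - apply (filterlim_comp _ _ _ Ropp gauss_int _ (Rbar_locally p_infty));
            [|exact HL].
          apply (filterlim_Rbar_opp m_infty).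
        - replace (L + gauss_int x) with (gauss_int x + L) by ring.
          apply (ex_derive_continuous (V := R_NormedModule) (fun z => gauss_int x + z)).
          auto_derive; trivial. }
      exact (F P HP).
    + reflexivity.
    + intros a b Ha <-. exists (gauss_int x - gauss_int a).
      split; [apply is_RInt_gauss|exact Ha].
  - assert (B : forall eps : posreal, - eps <= L - gauss_int x <= exp (/ 2 - x) + eps).
    { intros eps. apply filterlim_locally with (eps := eps) in HL.
      destruct HL as [M HM].
      set (b := Rmax (M + 1) x).
      assert (Hb : M < b) by (unfold b; pose proof (Rmax_l (M + 1) x); lra).
      assert (Hx : x <= b) by apply Rmax_r.
      specialize (HM b Hb). apply Rabs_lt_between in HM.
      change (minus (gauss_int b) L) with (gauss_int b - L) in HM.
      pose proof (gauss_int_diff_bounds x b Hx).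
      pose proof (exp_pos (/ 2 - b)). lra. }
    split; apply le_epsilon; intros e He; pose proof (B (mkposreal e He)); simpl in *;
      lra.
Qed.

Lemma is_derive_upper_gauss (x : R) : is_derive upper_gauss x (- gauss x).
Proof.
  destruct gauss_tails as [L HL].
  apply (is_derive_ext (fun y => L - gauss_int y)).
  - intros t. symmetry. apply HL.
  - replace (- gauss x) with (0 - gauss x) by ring.
    apply (is_derive_minus (V := R_NormedModule) (fun _ => L));
      [apply @is_derive_const|apply is_derive_gauss_int].
Qed.

Lemma upper_gauss_bounds (x : R) : 0 <= upper_gauss x <= exp (/ 2 - x).
Proof.
  destruct gauss_tails as [L HL]. destruct (HL x) as [-> [_ H]]. exact H.
Qed.

Lemma lower_gauss_upper (x : R) : lower_gauss x = upper_gauss (- x).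
Proof.
  destruct gauss_tails as [L HL].
  destruct (HL x) as [_ [-> _]]. destruct (HL (- x)) as [-> _].
  rewrite gauss_int_odd. ring.
Qed.

(** * The decaying solution *)

(* The solution of [y'' + x y' = (2n+1) y] that decays at [+oo]; [g n] is the
   other one. *)
Definition hg (n : nat) (x : R) : R := h n x * gauss x - g n x * upper_gauss x.
Definition dhg (n : nat) (x : R) : R :=
  (dh n x - x * h n x + g n x) * gauss x - dg n x * upper_gauss x.
(** The second derivative is defined through the differential equation; [is_derive_dhg] then states
    that [hg] solves it. *)
Definition ddhg (n : nat) (x : R) : R :=
  (2 * INR n + 1) * hg n x - x * dhg n x.

Lemma is_derive_eq (f : R -> R) (x l l' : R) :
  is_derive f x l -> l = l' -> is_derive f x l'.
Proof. now intros H <-. Qed.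

Lemma is_derive_hg (n : nat) (x : R) : is_derive (hg n) x (dhg n x).
Proof.
  unfold hg. eapply is_derive_eq.
  - apply (is_derive_minus (V := R_NormedModule)).
    + apply (is_derive_mult (h n) gauss); [apply is_derive_h|apply is_derive_gauss|].
      intros; apply Rmult_comm.
    + apply (is_derive_mult (g n) upper_gauss);
        [apply is_derive_g|apply is_derive_upper_gauss|intros; apply Rmult_comm].
  - unfold dhg, minus, plus, opp, mult; simpl. ring.
Qed.

Lemma is_derive_dhg (n : nat) (x : R) : is_derive (dhg n) x (ddhg n x).
Proof.
  unfold dhg. eapply is_derive_eq.
  - apply (is_derive_minus (V := R_NormedModule)).
    + apply (is_derive_mult (fun x => dh n x - x * h n x + g n x) gauss);
        [|apply is_derive_gauss|intros; apply Rmult_comm].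
      apply (is_derive_plus (V := R_NormedModule) (fun x => dh n x - x * h n x));
        [|apply is_derive_g].
      apply (is_derive_minus (V := R_NormedModule)); [apply is_derive_dh|].
      apply (is_derive_mult (fun x => x) (h n));
        [apply @is_derive_id|apply is_derive_h|intros; apply Rmult_comm].
    + apply (is_derive_mult (dg n) upper_gauss);
        [apply is_derive_dg|apply is_derive_upper_gauss|intros; apply Rmult_comm].
  - unfold ddhg, hg, dhg, minus, plus, opp, mult, one; simpl.
    pose proof (g_ode n x) as E1. pose proof (h_ode n x) as E2.
    replace (ddg n x) with ((2 * INR n + 1) * g n x - x * dg n x) by lra.
    replace (ddh n x) with (x * dh n x + (2 * INR n + 2) * h n x - 2 * dg n x) by lra.
    ring.
Qed.

(** The polynomial factor of the Gaussian is handled by [h_degree_succ] and that of the tail by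
    [g_ode] with [ddg_g]; both produce the same constant. *)
Lemma ddhg_succ (n : nat) (x : R) :
  ddhg (S n) x = (2 * INR n + 3) * (2 * INR n + 2) * hg n x.
Proof.
  pose proof (g_ode (S n) x) as E1. rewrite ddg_g in E1.
  pose proof (h_degree_succ n x) as E2.
  unfold ddhg, hg, dhg. rewrite S_INR in *.
  transitivity (((2 * INR n + 3) * h (S n) x - x * (dh (S n) x - x * h (S n) x + g
    (S n) x)) * gauss x - (2 * INR n + 3) * (2 * INR n + 2) * g n x * upper_gauss x).
  - replace ((2 * INR n + 3) * (2 * INR n + 2) * g n x) with ((2 * (INR n + 1) + 1) * g
      (S n) x - x * dg (S n) x) by lra.
    ring.
  - rewrite E2. ring.
Qed.

Lemma ddhg_0 (x : R) : ddhg 0 x = gauss x.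
Proof.
  unfold ddhg, dhg, hg. unfold dh, dg. rewrite h_coef, g_coef.
  cbn [sum_f_R0]. rewrite gcoef_diag, hcoef_diag. simpl. ring.
Qed.

(** * Decay at +oo and the sign of H_n *)

Definition poly_bounded (f : R -> R) : Prop :=
  exists K k, forall x, 0 <= x -> Rabs (f x) <= K * (1 + x) ^ k.

Lemma poly_bounded_nonneg (f : R -> R) : poly_bounded f ->
  exists K k, 0 <= K /\ forall x, 0 <= x -> Rabs (f x) <= K * (1 + x) ^ k.
Proof.
  intros [K [k B]]. exists K, k. split; [|exact B].
  specialize (B 0 (Rle_refl 0)). rewrite Rplus_0_r, pow1 in B.
  pose proof (Rabs_pos (f 0)). lra.
Qed.

Lemma poly_bounded_plus (f f' : R -> R) :
  poly_bounded f -> poly_bounded f' -> poly_bounded (fun x => f x + f' x).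
Proof.
  intros [K [k [HK B]]]%poly_bounded_nonneg [K' [k' [HK' B']]]%poly_bounded_nonneg.
  exists (K + K'), (k + k')%nat. intros x Hx.
  specialize (B x Hx). specialize (B' x Hx).
  pose proof (Rabs_triang (f x) (f' x)).
  pose proof (pow_R1_Rle (1 + x) k ltac:(lra)).
  pose proof (pow_R1_Rle (1 + x) k' ltac:(lra)).
  rewrite pow_add. set (a := (1 + x) ^ k) in *. set (b := (1 + x) ^ k') in *.
  assert (K * a <= K * (a * b)) by (apply Rmult_le_compat_l; nra).
  assert (K' * b <= K' * (a * b)) by (apply Rmult_le_compat_l; nra).
  lra.
Qed.

Lemma poly_bounded_mult (f f' : R -> R) :
  poly_bounded f -> poly_bounded f' -> poly_bounded (fun x => f x * f' x).
Proof.
  intros [K [k B]] [K' [k' B']].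
  exists (K * K'), (k + k')%nat. intros x Hx.
  rewrite Rabs_mult, pow_add.
  replace (K * K' * ((1 + x) ^ k * (1 + x) ^ k'))
    with ((K * (1 + x) ^ k) * (K' * (1 + x) ^ k')) by ring.
  apply Rmult_le_compat; auto using Rabs_pos.
Qed.

Lemma poly_bounded_const (a : R) : poly_bounded (fun _ => a).
Proof. exists (Rabs a), 0%nat. intros x _. simpl. lra. Qed.

Lemma poly_bounded_id : poly_bounded (fun x => x).
Proof. exists 1, 1%nat. intros x Hx. rewrite Rabs_pos_eq; simpl; lra. Qed.

Lemma poly_bounded_sum (a : nat -> R) (e : nat -> nat) (n : nat) :
  poly_bounded (fun x => sum_f_R0 (fun i => a i * x ^ e i) n).
Proof.
  assert (P : forall k, poly_bounded (fun x => x ^ k)).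
  { induction k as [|k IH]; simpl; [apply poly_bounded_const|].
    apply (poly_bounded_mult (fun x => x)); [apply poly_bounded_id|exact IH]. }
  induction n as [|n IH]; simpl; [|apply (poly_bounded_plus _ (fun x => a (S n) * x ^ e
    (S n))); [exact IH|]];
    (apply poly_bounded_mult; [apply poly_bounded_const|apply P]).
Qed.

Lemma poly_bounded_g (n : nat) : poly_bounded (g n).
Proof. apply (poly_bounded_sum (gcoef n)). Qed.

Lemma poly_bounded_dg (n : nat) : poly_bounded (dg n).
Proof. apply (poly_bounded_sum (fun i => gcoef n i * INR (2 * i + 1))). Qed.

Lemma poly_bounded_h (n : nat) : poly_bounded (h n).
Proof. apply (poly_bounded_sum (hcoef n)). Qed.

Lemma poly_bounded_dh (n : nat) : poly_bounded (dh n).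
Proof. apply (poly_bounded_sum (fun i => hcoef n i * INR (2 * i))). Qed.

(** The rate 1/(1+x) yields the two facts used below: boundedness on [0, oo) and the limit 0 at
    +oo. *)
Definition decays (f : R -> R) : Prop :=
  exists K, forall x, 0 <= x -> Rabs (f x) * (1 + x) <= K.

Lemma pow_le_exp (k : nat) (x : R) :
  0 <= x -> x ^ k <= INR (fact k) * exp x.
Proof.
  intros Hx. pose proof (exp_ge_taylor x k Hx) as T.
  assert (x ^ k / INR (fact k) <= exp x).
  { refine (Rle_trans _ _ _ _ T).
    destruct k; [simpl; lra|rewrite tech5].
    assert (0 <= sum_f_R0 (fun k => x ^ k / INR (fact k)) k); [|lra].
    apply cond_pos_sum. intros j. apply Rdiv_le_0_compat;
      [now apply pow_le|apply INR_fact_lt_0]. }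
  apply Rle_div_l in H; [lra|]. apply INR_fact_lt_0.
Qed.

(** The Gaussian and its tail are both at most e^(1/2 - x), while (1+x)^(k+1) <= (k+1)! e^(1+x); the
    product of the exponentials is the constant e^(3/2). *)
Lemma decays_gauss (p r : R -> R) : poly_bounded p -> poly_bounded r ->
  decays (fun x => p x * gauss x - r x * upper_gauss x).
Proof.
  intros [K [k [HK B]]]%poly_bounded_nonneg [K' [k' [HK' B']]]%poly_bounded_nonneg.
  exists (exp (3 / 2) * (K * INR (fact (S k)) + K' * INR (fact (S k')))).
  intros x Hx. specialize (B x Hx). specialize (B' x Hx).
  pose proof (upper_gauss_bounds x) as U. pose proof (gauss_le_exp x) as V.
  pose proof (gauss_pos x) as W.
  pose proof (pow_le_exp (S k) (1 + x) ltac:(lra)) as P.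
  pose proof (pow_le_exp (S k') (1 + x) ltac:(lra)) as P'.
  assert (E : exp (3 / 2) = exp (/ 2 - x) * exp (1 + x))
    by (rewrite <- exp_plus; f_equal; lra).
  rewrite E. pose proof (exp_pos (/ 2 - x)) as X.
  set (e := exp (/ 2 - x)) in *. set (w := exp (1 + x)) in *.
  apply Rle_trans with ((K * (1 + x) ^ k * e + K' * (1 + x) ^ k' * e) * (1 + x)).
  - apply Rmult_le_compat_r; [lra|].
    eapply Rle_trans; [apply Rabs_triang|].
    rewrite Rabs_Ropp, !Rabs_mult, (Rabs_pos_eq (gauss x)),
      (Rabs_pos_eq (upper_gauss x)) by lra.
    apply Rplus_le_compat; apply Rmult_le_compat; try apply Rabs_pos; lra.
  - simpl (_ ^ S _) in P, P'.
    assert (K * ((1 + x) * (1 + x) ^ k) <= K * (INR (fact (S k)) * w))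
      by now apply Rmult_le_compat_l.
    assert (K' * ((1 + x) * (1 + x) ^ k') <= K' * (INR (fact (S k')) * w))
      by now apply Rmult_le_compat_l.
    apply Rle_trans with (e * (K * ((1 + x) * (1 + x) ^ k) + K' * ((1 + x) *
      (1 + x) ^ k'))); [right; ring|].
    apply Rle_trans with (e * (K * (INR (fact (S k)) * w) + K' * (INR (fact
      (S k')) * w))); [|right; ring].
    apply Rmult_le_compat_l; lra.
Qed.

Lemma mean_value (f f1 : R -> R) (a b : R) : a < b ->
  (forall x, is_derive f x (f1 x)) ->
  exists c, a <= c <= b /\ f b - f a = f1 c * (b - a).
Proof.
  intros Hab D. destruct (MVT_gen f a b f1) as [c [Hc E]].
  - intros; apply D.
  - intros x _. apply derivable_continuous_pt. exists (f1 x). apply is_derive_Reals, D.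
  - exists c. rewrite Rmin_left, Rmax_right in Hc by lra. now split.
Qed.

Lemma increasing_of_derive_pos (f f1 : R -> R) :
  (forall x, is_derive f x (f1 x)) -> (forall x, 0 < f1 x) ->
  forall a b, a < b -> f a < f b.
Proof.
  intros D P a b Hab. destruct (mean_value f f1 a b Hab D) as [c [_ E]].
  specialize (P c). nra.
Qed.

(** If f x >= 0, then f exceeds the positive number f (x + 1) beyond x + 1, which contradicts the
    limit 0. *)
Lemma decays_increasing_neg (f : R -> R) :
  decays f -> (forall a b, a < b -> f a < f b) -> forall x, f x < 0.
Proof.
  intros [K HK] I x. apply Rnot_le_lt. intros H.
  set (s := f (x + 1)).
  assert (Hs : 0 < s) by (pose proof (I x (x + 1) ltac:(lra)); unfold s; lra).
  set (y := Rmax (x + 2) (Rmax 0 (K / s))).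
  assert (x + 2 <= y) by apply Rmax_l.
  assert (Rmax 0 (K / s) <= y) by apply Rmax_r.
  pose proof (Rmax_l 0 (K / s)). pose proof (Rmax_r 0 (K / s)).
  pose proof (I (x + 1) y ltac:(lra)) as Hy. fold s in Hy.
  specialize (HK y ltac:(lra)). rewrite Rabs_pos_eq in HK by lra.
  assert (K / s < 1 + y) by lra.
  apply Rlt_div_l in H4; [|exact Hs]. nra.
Qed.

(** A strictly convex function with a nonnegative slope somewhere eventually grows linearly, against
    boundedness. Hence the slope is negative everywhere, and a function decreasing to 0 is
    positive. *)
Lemma decays_convex (f f1 f2 : R -> R) :
  (forall x, is_derive f x (f1 x)) -> (forall x, is_derive f1 x (f2 x)) ->
  (forall x, 0 < f2 x) -> decays f -> forall x, 0 < f x /\ f1 x < 0.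
Proof.
  intros D1 D2 P Dec.
  pose proof (increasing_of_derive_pos f1 f2 D2 P) as I1.
  assert (N : forall x, f1 x < 0).
  { intros x. apply Rnot_le_lt. intros H.
    destruct Dec as [K HK].
    set (s := f1 (x + 1)).
    assert (Hs : 0 < s) by (pose proof (I1 x (x + 1) ltac:(lra)); unfold s; lra).
    set (z := Rmax (x + 1) 0).
    assert (x + 1 <= z) by apply Rmax_l. assert (0 <= z) by apply Rmax_r.
    assert (B0 : forall y, 0 <= y -> Rabs (f y) <= Rmax K 0).
    { intros y Hy. specialize (HK y Hy). pose proof (Rmax_l K 0).
      pose proof (Rabs_pos (f y)). nra. }
    (* Over [z, y] a slope of at least s forces a rise of s + 2 max(K, 0), more than the largest
       oscillation 2 max(K, 0) of f on [0, oo). *)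
    set (y := z + 1 + 2 * Rmax K 0 / s).
    pose proof (Rmax_r K 0).
    assert (0 <= 2 * Rmax K 0 / s) by (apply Rdiv_le_0_compat; lra).
    destruct (mean_value f f1 z y ltac:(unfold y; lra) D1) as [c [Hc E]].
    assert (s <= f1 c).
    { destruct (Req_dec c (x + 1)) as [->|]; [apply Rle_refl|].
      apply Rlt_le, I1. lra. }
    pose proof (B0 z ltac:(lra)) as Bz. pose proof (B0 y ltac:(unfold y; lra)) as By.
    apply Rabs_le_between in Bz. apply Rabs_le_between in By.
    assert (s * (y - z) = s + 2 * Rmax K 0) by (unfold y; field; lra).
    assert (0 < y - z) by (unfold y; lra).
    nra. }
  intros x. split; [|apply N].
  enough (- f x < 0) by lra.
  apply (decays_increasing_neg (fun x => - f x)).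
  - destruct Dec as [K HK]. exists K. intros y Hy. rewrite Rabs_Ropp. now apply HK.
  - apply (increasing_of_derive_pos _ (fun x => - f1 x)).
    + intros y. apply (is_derive_opp (V := R_NormedModule) f), D1.
    + intros y. specialize (N y). lra.
Qed.

(** Induction on n: the second derivative is the Gaussian for n = 0 and a positive multiple of the
    preceding [hg] afterwards, so positivity at one stage is convexity at the next. *)
Lemma hg_sign (n : nat) : forall x, 0 < hg n x /\ dhg n x < 0.
Proof.
  assert (Dec : forall n, decays (hg n))
    by (intros; apply decays_gauss; [apply poly_bounded_h|apply poly_bounded_g]).
  induction n as [|n IH];
    [apply (decays_convex _ _ (ddhg 0))|apply (decays_convex _ _ (ddhg (S n)))];
    auto using is_derive_hg, is_derive_dhg.
  - intros x. rewrite ddhg_0. apply gauss_pos.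
  - intros x. rewrite ddhg_succ. pose proof (pos_INR n).
    repeat apply Rmult_lt_0_compat; try lra. apply IH.
Qed.

Lemma hg_pos (n : nat) (x : R) : 0 < hg n x.
Proof. apply hg_sign. Qed.

Lemma dhg_neg (n : nat) (x : R) : dhg n x < 0.
Proof. apply hg_sign. Qed.

(* [x hg + hg'] is increasing, with derivative [(2n+2) hg], and tends to 0. *)
Lemma hg_log_derive (n : nat) (x : R) : x * hg n x + dhg n x < 0.
Proof.
  apply (decays_increasing_neg (fun x => x * hg n x + dhg n x)).
  - destruct (decays_gauss
      (fun x => x * h n x + (dh n x - x * h n x + g n x))
      (fun x => x * g n x + dg n x)) as [K HK].
    + apply poly_bounded_plus;
        [apply (poly_bounded_mult (fun x => x));
          [apply poly_bounded_id|apply poly_bounded_h]|].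
      apply (poly_bounded_plus (fun x => dh n x - x * h n x)); [|apply poly_bounded_g].
      apply (poly_bounded_plus (dh n) (fun x => - (x * h n x))); [apply poly_bounded_dh|].
      destruct (poly_bounded_mult (fun x => x) (h n)) as [K [k HK]];
        [apply poly_bounded_id|apply poly_bounded_h|].
      exists K, k. intros y Hy. rewrite Rabs_Ropp. now apply HK.
    + apply poly_bounded_plus; [|apply poly_bounded_dg].
      apply (poly_bounded_mult (fun x => x));
        [apply poly_bounded_id|apply poly_bounded_g].
    + exists K. intros y Hy. specialize (HK y Hy).
      replace (y * hg n y + dhg n y) with
       ((y * h n y + (dh n y - y * h n y + g n y)) * gauss y -
         (y * g n y + dg n y) * upper_gauss y); [exact HK|].
      unfold hg, dhg. ring.
  - apply (increasing_of_derive_pos _ (fun x => (2 * INR n + 2) * hg n x)).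
    + intros y. eapply is_derive_eq.
      * apply (is_derive_plus (V := R_NormedModule) (fun x => x * hg n x));
          [|apply is_derive_dhg].
        apply (is_derive_mult (fun x => x) (hg n));
          [apply @is_derive_id|apply is_derive_hg|intros; apply Rmult_comm].
      * unfold ddhg, plus, mult, one; simpl. ring.
    + intros y. pose proof (pos_INR n). pose proof (hg_pos n y). nra.
Qed.

(** * Wronskian, monotonicity and recurrences in n *)

Lemma g_0 (n : nat) : g n 0 = 0.
Proof.
  rewrite g_coef. rewrite (sum_eq _ (fun _ => 0)).
  - rewrite sum_cte. ring.
  - intros i _. rewrite pow_add. simpl. ring.
Qed.

Lemma sum_f_R0_even_0 (a : nat -> R) (n : nat) :
  sum_f_R0 (fun i => a i * 0 ^ (2 * i)) n = a 0%nat.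
Proof.
  induction n as [|n IH]; [simpl; ring|]. rewrite tech5, IH.
  replace (2 * S n)%nat with (S (2 * n + 1)) by lia.
  rewrite <- tech_pow_Rmult. ring.
Qed.

(** The value of the Wronskian at 0. At x = 0, [h_degree_succ] reduces to h_(n+1)(0) = (2n+2)
    h_n(0), so h_n(0) = 2^n n!, which cancels the double factorial in g_n'(0). *)
Lemma h_0_fact (n : nat) : dg n 0 * h n 0 = INR (fact (2 * n + 1)).
Proof.
  assert (E : forall n, h n 0 = 2 ^ n * INR (fact n)).
  { induction n0 as [|m IH].
    - rewrite h_coef. cbn [sum_f_R0]. rewrite hcoef_diag. simpl. ring.
    - pose proof (h_degree_succ m 0) as E. pose proof (pos_INR m).
      apply (Rmult_eq_reg_l (2 * INR m + 3)); [|lra].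
      rewrite IH in E. rewrite INR_fact_S. simpl (2 ^ S m). lra. }
  rewrite E. unfold dg. rewrite (sum_f_R0_even_0 (fun i => gcoef n i * INR (2 * i + 1))).
  unfold gcoef. rewrite Nat.sub_0_r, double_fact_even. simpl (INR (fact (2 * 0 + 1))).
    simpl (INR (2 * 0 + 1)).
  pose proof (INR_fact_neq_0 n). pose proof (pow_nonzero 2 n ltac:(lra)).
  field; split; assumption.
Qed.

(** The tail terms cancel identically and leave a polynomial [w] times the Gaussian. The two
    differential equations make the derivative of [w] zero, so [w] equals its value at 0. *)
Lemma wronskian (n : nat) (x : R) :
  dg n x * hg n x - g n x * dhg n x = INR (fact (2 * n + 1)) * gauss x.
Proof.
  set (w := fun x => (dg n x * h n x - g n x * (dh n x - x * h n x + g n x))).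
  assert (D : forall x, is_derive w x 0).
  { intros y. unfold w. eapply is_derive_eq.
    - apply (is_derive_minus (V := R_NormedModule)).
      + apply (is_derive_mult (dg n) (h n));
          [apply is_derive_dg|apply is_derive_h|intros; apply Rmult_comm].
      + apply (is_derive_mult (g n) (fun x => dh n x - x * h n x + g n x));
          [apply is_derive_g| |intros; apply Rmult_comm].
        apply (is_derive_plus (V := R_NormedModule) (fun x => dh n x - x * h n x));
          [|apply is_derive_g].
        apply (is_derive_minus (V := R_NormedModule)); [apply is_derive_dh|].
        apply (is_derive_mult (fun x => x) (h n));
          [apply @is_derive_id|apply is_derive_h|intros; apply Rmult_comm].
    - unfold minus, plus, opp, mult, one; simpl.
      pose proof (g_ode n y) as E1. pose proof (h_ode n y) as E2.
      replace (ddg n y) with ((2 * INR n + 1) * g n y - y * dg n y) by lra.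
      replace (ddh n y) with (y * dh n y + (2 * INR n + 2) * h n y - 2 * dg n y) by lra.
      ring. }
  assert (C : w x = w 0).
  { destruct (MVT_gen w 0 x (fun _ => 0)) as [z [_ Hz]].
    - intros; apply D.
    - intros y _. apply derivable_continuous_pt. exists 0. apply is_derive_Reals, D.
    - lra. }
  transitivity (w x * gauss x); [unfold w, hg, dhg; ring|].
  rewrite C. unfold w. rewrite g_0, <- h_0_fact. ring.
Qed.

Definition C2 (f f1 f2 : R -> R) : Prop :=
  (forall x, is_derive f x (f1 x)) /\
  (forall x, is_derive f1 x (f2 x)) /\
  (forall x, continuous f2 x).

(** The equation itself expresses the second derivative through f and f1, so its continuity is
    automatic. *)
Lemma C2_of_ode (f f1 : R -> R) (a b : R) :
  (forall x, is_derive f x (f1 x)) ->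
  (forall x, is_derive f1 x (a * f x - b * x * f1 x)) ->
  C2 f f1 (fun x => a * f x - b * x * f1 x).
Proof.
  intros D1 D2. split; [exact D1|split; [exact D2|]].
  intros x. apply (ex_derive_continuous (V := R_NormedModule)).
  assert (ex_derive f x) by (eexists; apply D1).
  assert (ex_derive f1 x) by (eexists; apply D2).
  auto_derive; tauto.
Qed.

Lemma g_neg (n : nat) (x : R) : g n (- x) = - g n x.
Proof.
  rewrite !g_coef.
  replace (- sum_f_R0 (fun i => gcoef n i * x ^ (2 * i + 1)) n)
    with ((-1) * sum_f_R0 (fun i => gcoef n i * x ^ (2 * i + 1)) n) by ring.
  rewrite scal_sum. apply sum_eq. intros i _.
  rewrite !pow_add, !pow_mult. replace ((- x) ^ 2) with (x ^ 2) by ring. ring.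
Qed.

Lemma h_neg (n : nat) (x : R) : h n (- x) = h n x.
Proof.
  rewrite !h_coef. apply sum_eq. intros i _.
  rewrite !pow_mult. now replace ((- x) ^ 2) with (x ^ 2) by ring.
Qed.

Lemma dg_neg (n : nat) (x : R) : dg n (- x) = dg n x.
Proof.
  unfold dg. apply sum_eq. intros i _.
  rewrite !pow_mult. now replace ((- x) ^ 2) with (x ^ 2) by ring.
Qed.

Lemma gauss_neg (x : R) : gauss (- x) = gauss x.
Proof. unfold gauss. now replace ((- x) ^ 2) with (x ^ 2) by ring. Qed.

Lemma dg_pos (n : nat) (x : R) : 0 < dg n x.
Proof.
  unfold dg.
  assert (P : forall i, 0 <= x ^ (2 * i))
    by (intros i; rewrite pow_mult; apply pow_le, pow2_ge_0).
  assert (Q : forall i, 0 < gcoef n i * INR (2 * i + 1)).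
  { intros i. apply Rmult_lt_0_compat; [apply gcoef_pos|apply lt_0_INR; lia]. }
  generalize n at 2. induction n0 as [|N IH].
  - cbn [sum_f_R0]. specialize (Q 0%nat). simpl (x ^ _). lra.
  - rewrite tech5. pose proof (Rmult_le_pos _ _ (Rlt_le _ _ (Q (S N))) (P (S N))). lra.
Qed.

Lemma g_increasing (n : nat) (a b : R) : a < b -> g n a < g n b.
Proof. apply (increasing_of_derive_pos _ (dg n)); auto using is_derive_g, dg_pos. Qed.

Lemma g_negative (n : nat) (x : R) : x < 0 -> g n x < 0.
Proof. intros H. rewrite <- (g_0 n). now apply g_increasing. Qed.

Lemma hg_decreasing (n : nat) (a b : R) : a < b -> hg n b < hg n a.
Proof.
  intros Hab.
  enough (- hg n a < - hg n b) by lra.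
  apply (increasing_of_derive_pos (fun x => - hg n x) (fun x => - dhg n x)); trivial.
  - intros x. apply (is_derive_opp (V := R_NormedModule) (hg n)), is_derive_hg.
  - intros x. pose proof (dhg_neg n x). lra.
Qed.

(** The derivative of the quotient is the Wronskian over [hg n x ^ 2]. The quotient decides the sign
    of g + k H: it vanishes where g/H = -k and is positive to the right of that point. *)
Lemma g_div_hg_increasing (n : nat) (a b : R) :
  a < b -> g n a / hg n a < g n b / hg n b.
Proof.
  apply (increasing_of_derive_pos (fun x => g n x / hg n x)
    (fun x => (dg n x * hg n x - g n x * dhg n x) / hg n x ^ 2)).
  - intros x. apply is_derive_div; [apply is_derive_g|apply is_derive_hg|].
    apply Rgt_not_eq, hg_pos.
  - intros x. rewrite wronskian. apply Rdiv_lt_0_compat.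
    + apply Rmult_lt_0_compat; [apply INR_fact_lt_0|apply gauss_pos].
    + apply pow_lt, hg_pos.
Qed.

(** Obtained by differentiating the expression of g_n through g_(n+1) and its slope given by [g_ode]
    and [ddg_g]. Together with [dhg_succ] it turns the slope of the profile at c into a Wronskian of
    index one lower. *)
Lemma dg_succ (n : nat) (x : R) :
  dg (S n) x = (2 * INR n + 3) * (dg n x + x * g n x).
Proof.
  assert (E : (2 * INR n + 3) * (2 * INR n + 2) * dg n x
    = (2 * INR n + 2) * dg (S n) x - x * ((2 * INR n + 3) * (2 * INR n + 2) * g n x)).
  { rewrite <- (is_derive_unique (fun x => (2 * INR n + 3) * (2 * INR n + 2) * g n x) x
      ((2 * INR n + 3) * (2 * INR n + 2) * dg n x))
      by (apply is_derive_scal, is_derive_g).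
    rewrite (Derive_ext _ (fun x => (2 * INR n + 3) * g (S n) x - x * dg (S n) x)).
    - apply is_derive_unique. eapply is_derive_eq.
      + apply (is_derive_minus (V := R_NormedModule) (fun x => (2 * INR n + 3) * g
          (S n) x)).
        * apply is_derive_scal, is_derive_g.
        * apply (is_derive_mult (fun x => x) (dg (S n)));
            [apply @is_derive_id|apply is_derive_dg|intros; apply Rmult_comm].
      + rewrite ddg_g. unfold minus, plus, opp, mult, one; simpl. ring.
    - intros t. pose proof (g_ode (S n) t) as E. rewrite ddg_g, S_INR in E. lra. }
  pose proof (pos_INR n).
  apply (Rmult_eq_reg_l (2 * INR n + 2)); [|lra]. lra.
Qed.

Lemma dhg_succ (n : nat) (x : R) :
  dhg (S n) x = (2 * INR n + 3) * (dhg n x + x * hg n x).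
Proof.
  assert (E : (2 * INR n + 3) * (2 * INR n + 2) * dhg n x
    = (2 * INR n + 2) * dhg (S n) x - x * ((2 * INR n + 3) * (2 * INR n + 2) * hg n x)).
  { rewrite <- (is_derive_unique (fun x => (2 * INR n + 3) * (2 * INR n + 2) * hg n x) x
      ((2 * INR n + 3) * (2 * INR n + 2) * dhg n x))
      by (apply is_derive_scal, is_derive_hg).
    rewrite (Derive_ext _ (fun x => (2 * INR n + 3) * hg (S n) x - x * dhg (S n) x)).
    - apply is_derive_unique. eapply is_derive_eq.
      + apply (is_derive_minus (V := R_NormedModule) (fun x => (2 * INR n + 3) * hg
          (S n) x)).
        * apply is_derive_scal, is_derive_hg.
        * apply (is_derive_mult (fun x => x) (dhg (S n)));
            [apply @is_derive_id|apply is_derive_dhg|intros; apply Rmult_comm].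
      + rewrite ddhg_succ. unfold minus, plus, opp, mult, one; simpl. ring.
    - intros t. rewrite <- ddhg_succ. unfold ddhg. rewrite S_INR. ring. }
  pose proof (pos_INR n).
  apply (Rmult_eq_reg_l (2 * INR n + 2)); [|lra]. lra.
Qed.

(** * Mills-type ratios and existence of the interface point *)

Definition mills (n : nat) (x : R) : R := hg n x / gauss x.

Lemma mills_pos (n : nat) (x : R) : 0 < mills n x.
Proof. apply Rdiv_lt_0_compat; [apply hg_pos|apply gauss_pos]. Qed.

Lemma exp_sq_gauss (x : R) : exp (x ^ 2 / 2) = / gauss x.
Proof. unfold gauss. rewrite <- exp_Ropp. f_equal. lra. Qed.

Lemma mills_upper (n : nat) (x : R) :
  h n x - g n x * exp (x ^ 2 / 2) * upper_gauss x = mills n x.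
Proof.
  rewrite exp_sq_gauss. unfold mills, hg. field. apply Rgt_not_eq, gauss_pos.
Qed.

(** By parity of g, h and the Gaussian, the bracket with the lower tail is the one with the upper
    tail at the reflected point. *)
Lemma mills_lower (n : nat) (x : R) :
  h n x + g n x * exp (x ^ 2 / 2) * lower_gauss x = mills n (- x).
Proof.
  rewrite <- mills_upper, h_neg, g_neg, lower_gauss_upper.
  replace ((- x) ^ 2) with (x ^ 2) by ring. ring.
Qed.

Lemma is_derive_mills (n : nat) (x : R) :
  is_derive (mills n) x ((x * hg n x + dhg n x) / gauss x).
Proof.
  unfold mills. eapply is_derive_eq.
  - apply is_derive_div; [apply is_derive_hg|apply is_derive_gauss|].
    apply Rgt_not_eq, gauss_pos.
  - field. apply Rgt_not_eq, gauss_pos.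
Qed.

Lemma mills_decreasing (n : nat) (a b : R) : a < b -> mills n b < mills n a.
Proof.
  intros Hab.
  enough (- mills n a < - mills n b) by lra.
  apply (increasing_of_derive_pos (fun x => - mills n x)
    (fun x => - ((x * hg n x + dhg n x) / gauss x))); trivial.
  - intros x. apply (is_derive_opp (V := R_NormedModule) (mills n)), is_derive_mills.
  - intros x. pose proof (hg_log_derive n x).
    pose proof (Rdiv_lt_0_compat _ _ (Ropp_0_gt_lt_contravar _ H) (gauss_pos x)).
    unfold Rdiv in *. lra.
Qed.

Lemma gauss_0 : gauss 0 = 1.
Proof. unfold gauss. replace (- 0 ^ 2 / 2) with 0 by field. apply exp_0. Qed.

(** Since [hg] decreases, its value at -a exceeds that at 0; hence the ratio grows at least like
    e^(a^2/2) towards -oo. *)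
Lemma mills_neg_lower_bound (n : nat) (a : R) :
  0 < a -> hg n 0 / gauss a < mills n (- a).
Proof.
  intros Ha. unfold mills. rewrite gauss_neg. unfold Rdiv.
  apply Rmult_lt_compat_r; [apply Rinv_0_lt_compat, gauss_pos|].
  apply hg_decreasing. lra.
Qed.

Lemma continuity_mills (n : nat) : continuity (mills n).
Proof.
  intros x. apply derivable_continuous_pt. eexists.
    apply is_derive_Reals, is_derive_mills.
Qed.

(** The intermediate value theorem for the difference of the two sides, with a = -c: at 0 both
    ratios equal [mills n 0] and sigma^p < 1 decides the sign, while for large a the growth of
    [mills n (- a)] wins. *)
Lemma mills_balance (n p : nat) (sigma : R) : 0 < sigma < 1 -> (0 < p)%nat ->
  exists a, 0 < a /\ mills n (a / sigma) = sigma ^ p * mills n (- a).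
Proof.
  intros Hs Hp.
  assert (S0 : 0 < sigma ^ p < 1)
    by (split; [apply pow_lt; lra|apply pow_lt_1_compat; lra || lia]).
  set (s := sigma ^ p) in *.
  (* Chosen so that e^(1/2 - b) = s e^(-1/2), which puts [gauss b] below s. *)
  set (b := 1 - ln s).
  assert (L : ln s < 0) by (rewrite <- ln_1; apply ln_increasing; lra).
  assert (Hb : 0 < b) by (unfold b; lra).
  assert (G : gauss b < s).
  { eapply Rle_lt_trans; [apply gauss_le_exp|].
    apply Rlt_le_trans with (exp (ln s)); [apply exp_increasing; unfold b;
      lra|]. rewrite exp_ln; lra. }
  set (f := fun a => s * mills n (- a) - mills n (a / sigma)).
  assert (C : continuity f).
  { apply continuity_minus.
    - apply continuity_mult; [apply continuity_const; now intros ??|].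
      apply (continuity_comp Ropp (mills n)); [|apply continuity_mills].
      apply continuity_opp, derivable_continuous, derivable_id.
    - apply (continuity_comp (fun a => a / sigma) (mills n)); [|apply continuity_mills].
      unfold Rdiv. apply continuity_mult;
        [apply derivable_continuous, derivable_id|apply continuity_const;
          now intros ??]. }
  destruct (IVT f 0 b C Hb) as [a [Ha E]].
  - unfold f. rewrite Ropp_0. replace (0 / sigma) with 0 by (field; lra).
    pose proof (mills_pos n 0). nra.
  - unfold f. pose proof (mills_neg_lower_bound n b Hb) as B.
    assert (mills n (b / sigma) < hg n 0).
    { replace (hg n 0) with (mills n 0) by (unfold mills; rewrite gauss_0; field).
      apply mills_decreasing. apply Rdiv_lt_0_compat; lra. }
    pose proof (gauss_pos b). pose proof (hg_pos n 0).
    assert (hg n 0 < s * (hg n 0 / gauss b)).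
    { replace (s * (hg n 0 / gauss b)) with (hg n 0 * s / gauss b) by (field; lra).
      apply Rlt_div_r; [lra|]. apply Rmult_lt_compat_l; lra. }
    pose proof (Rmult_lt_compat_l s _ _ (proj1 S0) B). lra.
  - exists a. unfold f in E. split; [|lra].
    destruct (Req_dec a 0) as [->|]; [|lra]. exfalso.
    rewrite Ropp_0 in E. replace (0 / sigma) with 0 in E by (field; lra).
    pose proof (mills_pos n 0). nra.
Qed.

Lemma mills_attains (n p : nat) (F : R) : 0 < F -> (0 < p)%nat ->
  exists a, 0 < a /\ F = a ^ p * mills n (- a).
Proof.
  intros HF Hp.
  set (f := fun a => a ^ p * mills n (- a) - F).
  assert (C : continuity f).
  { apply continuity_minus; [|apply continuity_const; now intros ??].
    apply continuity_mult; [apply derivable_continuous, derivable_pow|].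
    apply (continuity_comp Ropp (mills n)); [|apply continuity_mills].
    apply continuity_opp, derivable_continuous, derivable_id. }
  pose proof (hg_pos n 0) as H0.
  (* Then b * [hg n 0] = [hg n 0] + F > F, and b >= 1 gives b^p >= b. *)
  set (b := 1 + F / hg n 0).
  assert (Fq : 0 < F / hg n 0) by (now apply Rdiv_lt_0_compat).
  assert (Hb : 0 < b) by (unfold b; lra).
  assert (Z : f 0 < 0).
  { unfold f. rewrite pow_i by lia. lra. }
  destruct (IVT f 0 b C Hb Z) as [a [Ha E]].
  - unfold f. pose proof (mills_neg_lower_bound n b Hb) as B.
    assert (hg n 0 <= hg n 0 / gauss b).
    { apply Rle_div_r; [apply gauss_pos|].
      assert (gauss b <= 1); [|nra].
      rewrite <- exp_0. apply exp_le_compat. pose proof (pow2_ge_0 b). lra. }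
    assert (b <= b ^ p).
    { replace p with (S (pred p)) by lia. simpl.
      pose proof (pow_R1_Rle b (pred p) ltac:(unfold b; lra)). nra. }
    assert (b * hg n 0 = hg n 0 + F) by (unfold b; field; lra).
    assert (b * hg n 0 <= b ^ p * mills n (- b)) by (apply Rmult_le_compat; lra).
    lra.
  - exists a. split; [|unfold f in E; lra].
    destruct (Req_dec a 0) as [->|]; lra.
Qed.

(** * Comparison with touching classical solutions *)

Lemma G_monotone (sigma a b : R) : a <= b -> G sigma a <= G sigma b.
Proof.
  intros H. unfold G, neg_part, pos_part. pose proof (pow2_ge_0 sigma).
  set (s := sigma ^ 2) in *.
  unfold Rmax; repeat destruct Rle_dec; nra.
Qed.

(** The slopes of G are 1/2 and sigma^2/2, and sigma <= 1 makes 1/2 the larger one. *)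
Lemma G_plus_le (sigma a b : R) : 0 <= sigma <= 1 -> 0 <= b ->
  G sigma (a + b) <= G sigma a + b / 2.
Proof.
  intros Hs Hb. unfold G, neg_part, pos_part.
  assert (0 <= sigma ^ 2 <= 1) by (simpl; nra). set (s := sigma ^ 2) in *.
  unfold Rmax; repeat destruct Rle_dec; nra.
Qed.

Lemma locally_fst_pos (t x : R) : 0 < t ->
  locally (t, x) (fun p : R * R => 0 < fst p).
Proof.
  intros Ht. exists (mkposreal t Ht). intros [s y] [Hs _]. simpl in *.
  unfold ball in Hs; simpl in Hs; unfold AbsRing_ball, abs, minus, plus, opp in Hs;
    simpl in Hs.
  apply Rabs_def2 in Hs. lra.
Qed.

Lemma locally_slice_t (P : R * R -> Prop) (t x : R) :
  locally (t, x) P -> locally t (fun s => P (s, x)).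
Proof.
  intros [e H]. exists e. intros s Hs. apply H. split; [exact Hs|apply ball_center].
Qed.

Lemma locally_slice_x (P : R * R -> Prop) (t x : R) :
  locally (t, x) P -> locally x (fun y => P (t, y)).
Proof.
  intros [e H]. exists e. intros s Hs. apply H. split; [apply ball_center|exact Hs].
Qed.

(** The candidate derivatives agree with [dt], [dx], [dxx] only where t > 0, so continuity is
    transferred on a neighbourhood inside that half plane. *)
Lemma C12_intro (phi phit phix phixx : R -> R -> R) :
  (forall t x, 0 < t ->
     is_derive (fun s => phi s x) t (phit t x) /\
     is_derive (phi t) x (phix t x) /\
     is_derive (phix t) x (phixx t x) /\
     continuous (uncurry2 phi) (t, x) /\
     continuous (uncurry2 phit) (t, x) /\
     continuous (uncurry2 phix) (t, x) /\
     continuous (uncurry2 phixx) (t, x)) ->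
  C12 phi /\
  forall t x, 0 < t -> dt phi t x = phit t x /\ dxx phi t x = phixx t x.
Proof.
  intros H.
  assert (Et : forall t x, 0 < t -> dt phi t x = phit t x)
    by (intros t x Ht; apply is_derive_unique, (H t x Ht)).
  assert (Ex : forall t x, 0 < t -> dx phi t x = phix t x)
    by (intros t x Ht; apply is_derive_unique, (H t x Ht)).
  assert (Dx : forall t x, 0 < t -> is_derive (dx phi t) x (phixx t x)).
  { intros t x Ht. apply (is_derive_ext (phix t)); [|apply (H t x Ht)].
    intros y. now rewrite Ex. }
  assert (Exx : forall t x, 0 < t -> dxx phi t x = phixx t x)
    by (intros t x Ht; apply is_derive_unique, Dx, Ht).
  split; [|now auto].
  intros t x Ht. destruct (H t x Ht) as [H1 [H2 [H3 [H4 [H5 [H6 H7]]]]]].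
  assert (L : forall u v : R -> R -> R, (forall t x, 0 < t -> u t x = v t x) ->
    continuous (uncurry2 v) (t, x) -> continuous (uncurry2 u) (t, x)).
  { intros u v E. apply continuous_ext_loc.
    apply (filter_imp (fun p : R * R => 0 < fst p)); [|apply locally_fst_pos, Ht].
    intros [s y] Hs. symmetry. now apply E. }
  repeat split.
  - now exists (phit t x).
  - now exists (phix t x).
  - exists (phixx t x). now apply Dx.
  - exact H4.
  - now apply (L _ phit).
  - now apply (L _ phix).
  - now apply (L _ phixx).
Qed.

Lemma C12_plus (A B : R -> R -> R) : C12 A -> C12 B ->
  C12 (fun t x => A t x + B t x) /\
  forall t x, 0 < t ->
    dt (fun t x => A t x + B t x) t x = dt A t x + dt B t x /\
    dxx (fun t x => A t x + B t x) t x = dxx A t x + dxx B t x.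
Proof.
  intros HA HB.
  apply (C12_intro _ (fun t x => dt A t x + dt B t x)
           (fun t x => dx A t x + dx B t x) (fun t x => dxx A t x + dxx B t x)).
  intros t x Ht.
  destruct (HA t x Ht) as [A1 [A2 [A3 [A4 [A5 [A6 A7]]]]]].
  destruct (HB t x Ht) as [B1 [B2 [B3 [B4 [B5 [B6 B7]]]]]].
  split; [|split; [|split]].
  1: apply (is_derive_plus (V := R_NormedModule) (fun s => A s x) (fun s => B s x)).
  3: apply (is_derive_plus (V := R_NormedModule) (A t) (B t)).
  5: apply (is_derive_plus (V := R_NormedModule) (dx A t) (dx B t)).
  1-6: now apply Derive_correct.
  repeat split.
  - now apply (continuous_plus (V := R_NormedModule) (uncurry2 A) (uncurry2 B)).
  - now apply (continuous_plus (V := R_NormedModule) (uncurry2 (dt A)) (uncurry2 (dt B))).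
  - now apply (continuous_plus (V := R_NormedModule) (uncurry2 (dx A)) (uncurry2 (dx B))).
  - now apply (continuous_plus (V := R_NormedModule) (uncurry2 (dxx A)) (uncurry2
      (dxx B))).
Qed.

Lemma continuous_separated (a b : R -> R) (t x : R) :
  continuous a t -> continuous b x ->
  continuous (uncurry2 (fun t x => a t * b x)) (t, x).
Proof.
  intros Ha Hb.
  apply (continuous_mult (K := R_AbsRing) (fun p : R * R => a (fst p))
    (fun p : R * R => b (snd p))).
  - apply (continuous_comp (U := prod_UniformSpace R_UniformSpace R_UniformSpace) fst
      a); [apply continuous_fst|exact Ha].
  - apply (continuous_comp (U := prod_UniformSpace R_UniformSpace R_UniformSpace) snd
      b); [apply continuous_snd|exact Hb].
Qed.

Lemma local_max_derive (f : R -> R) (x l : R) : is_derive f x l ->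
  locally x (fun y => f y <= f x) -> l = 0.
Proof.
  intros D [e H]. apply is_derive_Reals in D.
  rewrite <- (derive_pt_eq_0 f x l (exist _ l D) D).
  apply (deriv_maximum f (x - e) (x + e)).
  - pose proof (cond_pos e). lra.
  - pose proof (cond_pos e). lra.
  - intros y Hy1 Hy2. apply H. apply Rabs_def1; unfold minus, plus, opp; simpl; lra.
Qed.

Lemma local_max_derive2 (f f1 : R -> R) (x l : R) :
  (forall y, is_derive f y (f1 y)) -> is_derive f1 x l ->
  locally x (fun y => f y <= f x) -> l <= 0.
Proof.
  intros D1 D2 M. apply Rnot_lt_le. intros Hl.
  pose proof (local_max_derive f x _ (D1 x) M) as Z.
  destruct M as [e M].
  apply is_derive_Reals in D2. destruct (D2 l Hl) as [d Hd].
  set (r := Rmin e d / 2).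
  assert (Hr : 0 < r /\ r < e /\ r < d).
  { pose proof (cond_pos e). pose proof (cond_pos d). unfold r.
    pose proof (Rmin_l e d). pose proof (Rmin_r e d).
    pose proof (Rmin_glb_lt e d 0 H H0). lra. }
  destruct (MVT_cor2 f f1 x (x + r)) as [c [E Hc]]; [lra|intros;
    apply is_derive_Reals, D1|].
  assert (f (x + r) <= f x).
  { apply M. apply Rabs_def1; unfold minus, plus, opp; simpl; lra. }
  specialize (Hd (c - x) ltac:(lra)).
  replace (x + (c - x)) with c in Hd by ring. rewrite Z, Rminus_0_r in Hd.
  assert (P : 0 < f1 c).
  { assert (Rabs (c - x) < d) as Q by (rewrite Rabs_pos_eq; lra).
    apply Hd in Q. apply Rabs_def2 in Q.
    assert (0 < f1 c / (c - x)) by lra.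
    replace (f1 c) with (f1 c / (c - x) * (c - x)) by (field; lra).
    apply Rmult_lt_0_compat; lra. }
  nra.
Qed.

(** The neighbourhood is two-sided in time, so the first-order condition there is an equality; in
    space the second-derivative test gives an inequality. *)
Lemma C12_touching (A phi : R -> R -> R) (t x : R) : C12 A -> C12 phi -> 0 < t ->
  locally (t, x) (fun p : R * R =>
    A (fst p) (snd p) - phi (fst p) (snd p) <= A t x - phi t x) ->
  dt A t x = dt phi t x /\ dxx A t x <= dxx phi t x.
Proof.
  intros HA HP Ht L. split.
  - apply Rminus_diag_uniq.
    apply (local_max_derive (fun s => A s x - phi s x) t).
    + apply (is_derive_minus (V := R_NormedModule) (fun s => A s x) (fun s => phi s x));
        apply Derive_correct; [apply (HA t x Ht)|apply (HP t x Ht)].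
    + now apply locally_slice_t in L.
  - apply Rminus_le.
    apply (local_max_derive2 (fun y => A t y - phi t y)
      (fun y => dx A t y - dx phi t y) x).
    + intros y. apply (is_derive_minus (V := R_NormedModule) (A t) (phi t));
        apply Derive_correct; [apply (HA t y Ht)|apply (HP t y Ht)].
    + apply (is_derive_minus (V := R_NormedModule) (dx A t) (dx phi t));
        apply Derive_correct; [apply (HA t x Ht)|apply (HP t x Ht)].
    + now apply locally_slice_x in L.
Qed.

(** * Maxima on rectangles and the barrier *)

Lemma list_argmax {T : Type} (F : T -> R) (l : list T) : l <> nil ->
  exists t, List.In t l /\ forall t', List.In t' l -> F t' <= F t.
Proof.
  induction l as [|a l IH]; [easy|intros _].
  destruct l as [|b l].
  - exists a. split; [now left|]. intros t' [->|[]]. apply Rle_refl.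
  - destruct IH as [t [Ht Mt]]; [easy|].
    destruct (Rle_dec (F t) (F a)) as [H|H].
    + exists a. split; [now left|]. intros t' [->|Ht']; [apply Rle_refl|].
      apply Rle_trans with (F t); auto.
    + exists t. split; [now right|]. intros t' [->|Ht']; [lra|auto].
Qed.

(** Without a maximum, every point has a neighbourhood on which f stays below its value at some
    other point q. Among the finitely many q of a finite subcover the best one lies in a member of
    the cover, hence has a value below that of another q. *)
Lemma max_on_rectangle (f : R -> R -> R) (a b c d : R) : a <= b -> c <= d ->
  (forall t x, a <= t <= b -> c <= x <= d -> forall e : posreal,
     exists del : posreal, forall s y, a <= s <= b -> c <= y <= d ->
       Rabs (s - t) < del -> Rabs (y - x) < del -> f s y < f t x + e) ->
  exists t x, (a <= t <= b /\ c <= x <= d) /\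
    forall s y, a <= s <= b -> c <= y <= d -> f s y <= f t x.
Proof.
  intros Hab Hcd usc. apply Classical_Prop.NNPP. intros no.
  (* Points are nested pairs ending in [unit], the format of [compactness_list]. *)
  pose (rect := fun p : R * (R * unit) => a <= fst p <= b /\ c <= fst (snd p) <= d).
  pose (fp := fun p : R * (R * unit) => f (fst p) (fst (snd p))).
  assert (step : forall p, exists dq : posreal * (R * (R * unit)), rect (snd dq) /\
    (rect p -> forall r, rect r -> Rabs (fst r - fst p) < fst dq ->
       Rabs (fst (snd r) - fst (snd p)) < fst dq -> fp r < fp (snd dq))).
  { intros [t [x []]]. destruct (Classical_Prop.classic (rect (t, (x, tt)))) as [Hp|Hp].
    - destruct (Classical_Prop.classic (exists q,
        rect q /\ f t x < fp q)) as [[q [Hq Lq]]|Nq].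
      + assert (He : 0 < fp q - f t x) by lra.
        destruct Hp as [Hp1 Hp2]; simpl in Hp1, Hp2.
        destruct (usc t x Hp1 Hp2 (mkposreal _ He)) as [del Hdel].
        exists (del, q). split; [exact Hq|].
        intros _ [s [y []]] [R1 R2] C1 C2. specialize (Hdel s y R1 R2 C1 C2).
        simpl in Hdel. unfold fp at 1; simpl. lra.
      + exfalso. apply no. exists t, x. split; [exact Hp|].
        intros s y Hs Hy. apply Rnot_lt_le. intros L. apply Nq.
        now exists (s, (y, tt)).
    (* Junk value outside the rectangle, since the radius function must be total. *)
    - exists (mkposreal 1 Rlt_0_1, (a, (c, tt))). split; [split; simpl; lra|].
      intros Hp'. now contradiction Hp. }
  pose (dq := fun p => proj1_sig (constructive_indefinite_description _ (step p))).
  assert (Hdq : forall p, rect (snd (dq p)) /\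
    (rect p -> forall r, rect r -> Rabs (fst r - fst p) < fst (dq p) ->
       Rabs (fst (snd r) - fst (snd p)) < fst (dq p) -> fp r < fp (snd (dq p))))
    by (intros p; exact (proj2_sig (constructive_indefinite_description _ (step p)))).
  (* The finite subcover is only given under a double negation, which the goal [False] absorbs. *)
  apply (compactness_list 2 (a, (c, tt)) (b, (d, tt)) (fun p => fst (dq p))).
  intros [l Hl].
  destruct (list_argmax (fun p => fp (snd (dq p))) l) as [p [_ Mp]].
  { intros ->. destruct (Hl (a, (c, tt))) as [? [[] _]]. simpl. repeat split; lra. }
  destruct (Hdq p) as [Rq _]. cbv beta in Mp.
  destruct (snd (dq p)) as [q1 [q2 []]]. destruct Rq as [R1 R2]; simpl in R1, R2.
  destruct (Hl (q1, (q2, tt))) as [[p1 [p2 []]] [I [[B1 [B2 _]] [C1 [C2 _]]]]].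
  { simpl. repeat split; lra. }
  destruct (Hdq (p1, (p2, tt))) as [_ K].
  specialize (Mp _ I).
  apply (Rle_not_lt _ _ Mp).
  apply K; [split; simpl; lra|split; simpl; lra|exact C1|exact C2].
Qed.

(** The exponent is one more than that of the growth bound K (1 + x^2)^p: the extra factor makes the
    barrier dominate for large x at every time in [0, T + 1], and for all x at T + 1, where the
    exponential is 1. *)
Definition barrier (K lambda T : R) (p : nat) (t x : R) : R :=
  K * exp (lambda * (t - (T + 1))) * (1 + x ^ 2) ^ S p.

Lemma barrier_C12 (K lambda T : R) (p : nat) :
  C12 (barrier K lambda T p) /\
  forall t x, 0 < t ->
    dt (barrier K lambda T p) t x = lambda * barrier K lambda T p t x /\
    dxx (barrier K lambda T p) t x
    = K * exp (lambda * (t - (T + 1)))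
      * (INR (S p) * (2 * (1 + x ^ 2) ^ p
                      + INR p * (1 + x ^ 2) ^ pred p * (4 * x ^ 2))).
Proof.
  set (w := fun x => (1 + x ^ 2) ^ S p).
  set (w1 := fun x => INR (S p) * (1 + x ^ 2) ^ p * (2 * x)).
  set (w2 := fun x => INR (S p) * (2 * (1 + x ^ 2) ^ p
                      + INR p * (1 + x ^ 2) ^ pred p * (4 * x ^ 2))).
  set (e := fun t => K * exp (lambda * (t - (T + 1)))).
  assert (De : forall t, is_derive e t (lambda * e t)).
  { intros t. unfold e. auto_derive; trivial. unfold Rminus. ring. }
  assert (Dw : forall x, is_derive w x (w1 x)).
  { intros x. unfold w, w1. eapply is_derive_eq.
    - apply (is_derive_pow (fun x => 1 + x ^ 2)). auto_derive; trivial.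
    - cbn [pred]. simpl. ring. }
  assert (Dw1 : forall x, is_derive w1 x (w2 x)).
  { intros x. unfold w1, w2. eapply is_derive_eq.
    - apply (is_derive_mult (fun x => INR (S p) * (1 + x ^ 2) ^ p) (fun x => 2 * x)).
      + apply is_derive_scal. apply (is_derive_pow (fun x => 1 + x ^ 2)). auto_derive;
          trivial.
      + auto_derive; trivial.
      + intros; apply Rmult_comm.
    - unfold plus, mult; simpl. ring. }
  assert (Cw2 : forall x, continuous w2 x).
  { intros x. apply (ex_derive_continuous (V := R_NormedModule)). unfold w2.
    auto_derive; trivial. }
  assert (C : forall f f1 : R -> R, (forall x, is_derive f x (f1 x)) -> forall x,
    continuous f x).
  { intros f f1 D x. apply (ex_derive_continuous (V := R_NormedModule)). eexists;
      apply D. }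
  destruct (C12_intro (barrier K lambda T p) (fun t x => lambda * e t * w x)
    (fun t x => e t * w1 x) (fun t x => e t * w2 x)) as [Cb Db].
  - intros t x _. refine (conj _ (conj _ (conj _ (conj _ (conj _ (conj _ _)))))).
    + apply (is_derive_ext (fun s => w x * e s)); [intros s; apply Rmult_comm|].
      eapply is_derive_eq; [apply (is_derive_scal e), De|apply Rmult_comm].
    + apply (is_derive_scal w), Dw.
    + apply (is_derive_scal w1), Dw1.
    + apply (continuous_separated e w); [apply (C e _ De)|apply (C w _ Dw)].
    + apply (continuous_separated (fun t => lambda * e t) w); [|apply (C w _ Dw)].
      apply (C _ (fun t => lambda * (lambda * e t))).
      intros s. apply (is_derive_scal e), De.
    + apply (continuous_separated e w1); [apply (C e _ De)|apply (C w1 _ Dw1)].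
    + apply (continuous_separated e w2); [apply (C e _ De)|apply Cw2].
  - split; [exact Cb|]. intros t x Ht. destruct (Db t x Ht) as [-> ->].
    split; [unfold barrier, e, w; ring|reflexivity].
Qed.

Lemma barrier_pos (K lambda T : R) (p : nat) (t x : R) :
  0 < K -> 0 < barrier K lambda T p t x.
Proof.
  intros HK. unfold barrier. pose proof (pow2_ge_0 x).
  apply Rmult_lt_0_compat; [|apply pow_lt; lra].
  apply Rmult_lt_0_compat; [exact HK|apply exp_pos].
Qed.

(** With z = 1 + x^2, the second derivative of z^(p+1) is at most (p+1)(2 + 4p) z^p, since 4 x^2 <=
    4 z; this is the threshold for lambda. Halving the second derivative matches [G_plus_le]. *)
Lemma barrier_strict (K lambda T : R) (p : nat) (t x : R) : 0 < K ->
  INR (S p) * (2 + 4 * INR p) < lambda -> 0 < t ->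
  0 <= dxx (barrier K lambda T p) t x / 2 < dt (barrier K lambda T p) t x.
Proof.
  intros HK HL Ht.
  destruct (proj2 (barrier_C12 K lambda T p) t x Ht) as [-> ->].
  unfold barrier. set (E := K * exp (lambda * (t - (T + 1)))).
  assert (HE : 0 < E) by (apply Rmult_lt_0_compat; [exact HK|apply exp_pos]).
  pose proof (pow2_ge_0 x) as Hx. pose proof (pos_INR p) as Hp.
  set (z := 1 + x ^ 2) in *. assert (Hz : 1 <= z) by (unfold z; lra).
  pose proof (pow_lt z p ltac:(lra)) as P0.
  assert (P1 : 0 <= INR p * z ^ pred p * (4 * x ^ 2) <= 4 * INR p * z ^ p).
  { destruct p as [|p]; [simpl (INR 0); rewrite !Rmult_0_r, !Rmult_0_l; simpl; lra|].
    cbn [pred]. pose proof (pow_lt z p ltac:(lra)). simpl (z ^ S p).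
    assert (0 <= INR (S p) * z ^ p) by nra.
    split; [nra|].
    replace (4 * INR (S p) * (z * z ^ p)) with (INR (S p) * z ^ p * (4 * z)) by ring.
    apply Rmult_le_compat_l; [assumption|]. unfold z. lra. }
  assert (Hsp : 1 <= INR (S p)) by (rewrite S_INR; lra).
  set (Q := INR p * z ^ pred p * (4 * x ^ 2)) in *.
  assert (0 <= INR (S p) * (2 * z ^ p + Q) <= INR (S p) * (2 + 4 * INR p) * z ^ p).
  { split; [nra|]. rewrite Rmult_assoc. apply Rmult_le_compat_l; lra. }
  assert (z ^ p <= z ^ S p) by (simpl; nra).
  set (L := INR (S p) * (2 + 4 * INR p)) in *.
  assert (0 < L) by (unfold L; nra).
  assert (INR (S p) * (2 * z ^ p + Q) < lambda * z ^ S p).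
  { apply Rle_lt_trans with (L * z ^ p); [lra|].
    apply Rle_lt_trans with (L * z ^ S p); [apply Rmult_le_compat_l; lra|].
    apply Rmult_lt_compat_r; lra. }
  set (V := INR (S p) * (2 * z ^ p + Q)) in *.
  assert (0 <= E * V) by nra.
  assert (E * V < E * (lambda * z ^ S p)) by (apply Rmult_lt_compat_l; lra).
  split; lra.
Qed.

Lemma half_plane_usc (D : R -> R -> R) :
  continuous_on (fun p : R * R => 0 <= fst p) (uncurry2 D) ->
  forall t x, 0 <= t -> forall e : posreal, exists del : posreal, forall s y,
    0 <= s -> Rabs (s - t) < del -> Rabs (y - x) < del -> Rabs (D s y - D t x) < e.
Proof.
  intros C t x Ht e. specialize (C (t, x) Ht).
  apply filterlim_locally with (eps := e) in C.
  destruct C as [del H]. exists del. intros s y Hs H1 H2.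
  exact (H (s, y) (conj H1 H2) Hs).
Qed.

(* At [t = T + 1] the barrier dominates the growth bound on [D], so a positive
   maximum of [D - barrier] is attained at an interior time. *)
Lemma barrier_interior_max (D : R -> R -> R) (K lambda T : R) (p : nat) (t1 x1 : R) :
  continuous_on (fun q : R * R => 0 <= fst q) (uncurry2 D) ->
  (forall x, D 0 x <= 0) -> 0 < K -> 0 <= lambda ->
  (forall t x, 0 <= t <= T + 1 -> Rabs (D t x) <= K * (1 + x ^ 2) ^ p) ->
  0 <= t1 <= T -> barrier K lambda T p t1 x1 < D t1 x1 ->
  exists t x, 0 < t /\ locally (t, x) (fun q : R * R =>
    D (fst q) (snd q) - barrier K lambda T p (fst q) (snd q)
    <= D t x - barrier K lambda T p t x).
Proof.
  intros HC H0 HK Hl HB Ht1 Hpos.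
  set (m := fun t x => D t x - barrier K lambda T p t x).
  (* For |x| >= M the factor 1 + x^2 outweighs the smallest value e^(-lambda (T+1)) of the
     exponential on [0, T + 1], and x1 lies strictly inside. *)
  set (M := 1 + Rabs x1 + exp (lambda * (T + 1))).
  pose proof (Rabs_pos x1) as Hx1. pose proof (exp_pos (lambda * (T + 1))) as Hexp.
  assert (edge : forall t x, 0 <= t <= T + 1 ->
    t = 0 \/ t = T + 1 \/ M <= Rabs x -> m t x <= 0).
  { intros t x Ht Hedge. unfold m.
    pose proof (barrier_pos K lambda T p t x HK) as Hb.
    destruct Hedge as [->|Hedge]; [specialize (H0 x); lra|].
    specialize (HB t x Ht). pose proof (Rle_abs (D t x)).
    enough (K * (1 + x ^ 2) ^ p <= barrier K lambda T p t x) by lra.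
    unfold barrier. change ((1 + x ^ 2) ^ S p) with ((1 + x ^ 2) * (1 + x ^ 2) ^ p).
    pose proof (pow2_ge_0 x) as Hx. pose proof (pow_lt (1 + x ^ 2) p ltac:(lra)) as P.
    assert (1 <= exp (lambda * (t - (T + 1))) * (1 + x ^ 2)).
    { destruct Hedge as [->|Hedge].
      - replace (lambda * (T + 1 - (T + 1))) with 0 by ring. rewrite exp_0. lra.
      - assert (exp (lambda * (T + 1)) <= 1 + x ^ 2).
        { rewrite <- (pow2_abs x). unfold M in Hedge. simpl. nra. }
        replace (lambda * (t - (T + 1))) with (lambda * t + - (lambda * (T + 1))) by ring.
        rewrite exp_plus, exp_Ropp.
        assert (1 <= exp (lambda * t)).
        { rewrite <- exp_0. apply exp_le_compat. apply Rmult_le_pos; lra. }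
        assert (1 <= / exp (lambda * (T + 1)) * (1 + x ^ 2)).
        { rewrite Rmult_comm. apply Rle_div_r; lra. }
        rewrite Rmult_assoc. nra. }
    apply Rle_trans with (K * (1 + x ^ 2) ^ p * (exp (lambda * (t - (T + 1))) *
      (1 + x ^ 2))); [|right; ring].
    rewrite <- (Rmult_1_r (K * (1 + x ^ 2) ^ p)) at 1.
    apply Rmult_le_compat_l; [nra|assumption]. }
  destruct (max_on_rectangle m 0 (T + 1) (- M) M) as [t [x [[Ht Hx] Hmax]]].
  - lra.
  - unfold M; lra.
  - intros t x Ht Hx e.
    assert (He : 0 < e / 2) by (pose proof (cond_pos e); lra).
    destruct (half_plane_usc D HC t x ltac:(lra) (mkposreal _ He)) as [d1 Hd1].
    assert (CB : continuous (uncurry2 (barrier K lambda T p)) (t, x)).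
    { apply (continuous_separated (fun t => K * exp (lambda * (t - (T + 1)))) (fun x =>
        (1 + x ^ 2) ^ S p));
        apply (ex_derive_continuous (V := R_NormedModule)); auto_derive; trivial. }
    unfold continuous in CB.
    apply filterlim_locally with (eps := mkposreal _ He) in CB.
    destruct CB as [d2 Hd2].
    assert (Hd : 0 < Rmin d1 d2) by (apply Rmin_glb_lt; apply cond_pos).
    exists (mkposreal _ Hd). simpl. intros s y Hs Hy Cs Cy.
    pose proof (Rmin_l d1 d2). pose proof (Rmin_r d1 d2).
    specialize (Hd1 s y ltac:(lra) ltac:(lra) ltac:(lra)). simpl in Hd1.
    assert (Q : Rabs (barrier K lambda T p s y - barrier K lambda T p t x) < e / 2).
    { apply (Hd2 (s, y)). split; unfold ball; simpl;
        unfold AbsRing_ball, abs, minus, plus, opp; simpl.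
      - apply Rlt_le_trans with (Rmin d1 d2); assumption.
      - apply Rlt_le_trans with (Rmin d1 d2); assumption. }
    apply Rabs_def2 in Hd1. apply Rabs_def2 in Q. unfold m. lra.
  - assert (Hm : 0 < m t x).
    { apply Rlt_le_trans with (m t1 x1); [unfold m; lra|].
      apply Hmax; [lra|]. apply Rabs_le_between. unfold M. lra. }
    assert (I : 0 < t < T + 1 /\ Rabs x < M).
    { repeat split.
      - destruct (Req_dec t 0) as [E|]; [|lra].
        pose proof (edge t x Ht (or_introl E)). lra.
      - destruct (Req_dec t (T + 1)) as [E|]; [|lra].
        pose proof (edge t x Ht (or_intror (or_introl E))). lra.
      - apply Rnot_le_lt. intros E.
        pose proof (edge t x Ht (or_intror (or_intror E))). lra. }
    destruct I as [It Ix]. apply Rabs_def2 in Ix.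
    exists t, x. split; [lra|].
    set (r := Rmin (Rmin t (T + 1 - t)) (Rmin (M - x) (M + x))).
    assert (Hr : 0 < r) by (repeat apply Rmin_glb_lt; lra).
    exists (mkposreal r Hr). intros [s y] [Hs Hy].
    assert (r <= Rmin t (T + 1 - t)) by apply Rmin_l.
    assert (r <= Rmin (M - x) (M + x)) by apply Rmin_r.
    pose proof (Rmin_l t (T + 1 - t)). pose proof (Rmin_r t (T + 1 - t)).
    pose proof (Rmin_l (M - x) (M + x)). pose proof (Rmin_r (M - x) (M + x)).
    change (Rabs (s - t) < r) in Hs. change (Rabs (y - x) < r) in Hy.
    apply Rabs_def2 in Hs. apply Rabs_def2 in Hy.
    simpl. apply Hmax; lra.
Qed.

(** For t <= T the barrier is at most W e^(-lambda) with W independent of lambda, and lambda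
    e^(-lambda) < 1. The choice of lambda contains W/z, so that a positive z would give z lambda > W
    and z lambda < W. *)
Lemma barrier_vanishes (K T z : R) (p : nat) (t x L : R) : 0 < K -> t <= T ->
  (forall lambda, L < lambda -> 0 <= lambda -> z <= barrier K lambda T p t x) -> z <= 0.
Proof.
  intros HK Ht H. apply Rnot_lt_le. intros Hz.
  set (W := K * (1 + x ^ 2) ^ S p).
  assert (HW : 0 < W).
  { apply Rmult_lt_0_compat; [exact HK|]. apply pow_lt. pose proof (pow2_ge_0 x). lra. }
  set (lambda := 1 + Rabs L + W / z).
  assert (0 < W / z) by (now apply Rdiv_lt_0_compat).
  pose proof (Rle_abs L). pose proof (Rabs_pos L).
  assert (Hl : 0 < lambda) by (unfold lambda; lra).
  specialize (H lambda ltac:(unfold lambda; lra) ltac:(lra)).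
  assert (E : exp (lambda * (t - (T + 1))) <= exp (- lambda)).
  { apply exp_le_compat. nra. }
  assert (exp (- lambda) * lambda < 1).
  { rewrite exp_Ropp. pose proof (exp_ineq1 lambda ltac:(lra)).
      pose proof (exp_pos lambda).
    rewrite Rmult_comm. apply Rlt_div_l; lra. }
  assert (z <= W * exp (- lambda)).
  { eapply Rle_trans; [exact H|]. unfold barrier, W.
    replace (K * exp (lambda * (t - (T + 1))) * (1 + x ^ 2) ^ S p)
      with (K * (1 + x ^ 2) ^ S p * exp (lambda * (t - (T + 1)))) by ring.
    apply Rmult_le_compat_l; [apply Rlt_le, HW|exact E]. }
  assert (z * lambda = z * (1 + Rabs L) + W) by (unfold lambda; field; lra).
  pose proof (exp_pos (- lambda)).
  assert (z * lambda <= W * (exp (- lambda) * lambda)) by nra.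
  nra.
Qed.

(* Local classical barriers touching [u]; when [u] is itself of class C^{1,2},
   both can be taken equal to [u]. *)
Definition bracketed (sigma : R) (u : R -> R -> R) : Prop :=
  forall t x, 0 < t -> exists A B : R -> R -> R,
    C12 A /\ C12 B /\ A t x = u t x /\ B t x = u t x /\
    locally (t, x) (fun p : R * R =>
      A (fst p) (snd p) <= u (fst p) (snd p) <= B (fst p) (snd p)) /\
    dt A t x <= G sigma (dxx A t x) /\ G sigma (dxx B t x) <= dt B t x.

(** A test function touching u from above also touches the lower function A from above, so its
    derivatives compare with those of A, and G is monotone. *)
Lemma bracketed_subsolution (sigma : R) (u : R -> R -> R) :
  bracketed sigma u -> viscosity_subsolution sigma u.
Proof.
  intros br phi t x Hphi Ht L.
  destruct (br t x Ht) as [A [B [CA [CB [EA [EB [LAB [SA SB]]]]]]]].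
  destruct (C12_touching A phi t x CA Hphi Ht) as [E1 E2].
  - generalize (filter_and _ _ L LAB). apply filter_imp. intros p [H1 H2]. lra.
  - pose proof (G_monotone sigma _ _ E2). lra.
Qed.

Lemma bracketed_supersolution (sigma : R) (u : R -> R -> R) :
  bracketed sigma u -> viscosity_supersolution sigma u.
Proof.
  intros br phi t x Hphi Ht L.
  destruct (br t x Ht) as [A [B [CA [CB [EA [EB [LAB [SA SB]]]]]]]].
  destruct (C12_touching phi B t x Hphi CB Ht) as [E1 E2].
  - generalize (filter_and _ _ L LAB). apply filter_imp. intros p [H1 H2]. lra.
  - pose proof (G_monotone sigma _ _ E2). lra.
Qed.

Lemma continuous_on_minus (D : R * R -> Prop) (u v : R -> R -> R) :
  continuous_on D (uncurry2 u) -> continuous_on D (uncurry2 v) ->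
  continuous_on D (uncurry2 (fun t x => u t x - v t x)).
Proof.
  intros Cu Cv p Hp.
  apply (filterlim_comp_2 (G := locally (uncurry2 u p)) (H := locally (uncurry2 v p))
    (uncurry2 u) (uncurry2 v) Rminus (Cu p Hp) (Cv p Hp)).
  apply (filterlim_comp_2 (G := locally (uncurry2 u p)) (H := locally (opp
    (uncurry2 v p)))
    fst (fun q : R * R => opp (snd q)) Rplus).
  - apply filterlim_fst.
  - apply (filterlim_comp _ _ _ snd opp _ (locally (uncurry2 v p)));
      [apply filterlim_snd|].
    apply (filterlim_opp (V := R_NormedModule)).
  - apply (filterlim_plus (V := R_NormedModule)).
Qed.

(** Passes to the smooth weight 1 + x^2, from which the barrier is built, by means of |x| <= 1 +
    x^2. *)
Lemma polynomial_growth_minus (u v : R -> R -> R) (T : R) :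
  polynomial_growth u -> polynomial_growth v -> 0 < T ->
  exists K p, 0 < K /\ forall t x, 0 <= t <= T ->
    Rabs (u t x - v t x) <= K * (1 + x ^ 2) ^ p.
Proof.
  intros Gu Gv HT.
  destruct (Gu T HT) as [K [p Hu]]. destruct (Gv T HT) as [K' [p' Hv]].
  exists (2 * (Rabs K + Rabs K') + 1), (p + p')%nat.
  pose proof (Rabs_pos K) as HK. pose proof (Rabs_pos K') as HK'.
  split; [lra|]. intros t x Ht. specialize (Hu t x Ht). specialize (Hv t x Ht).
  pose proof (pow2_ge_0 x) as Hx.
  assert (B : forall q q', 1 + Rabs x ^ q <= 2 * (1 + x ^ 2) ^ (q + q')).
  { intros q q'.
    assert (Rabs x ^ q <= (1 + x ^ 2) ^ q).
    { apply pow_incr. split; [apply Rabs_pos|].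
      rewrite <- (pow2_abs x). pose proof (pow2_ge_0 (Rabs x - 1 / 2)). lra. }
    pose proof (pow_R1_Rle (1 + x ^ 2) q ltac:(lra)).
    pose proof (pow_R1_Rle (1 + x ^ 2) q' ltac:(lra)).
    rewrite pow_add. nra. }
  pose proof (B p p') as B1. pose proof (B p' p) as B2.
  rewrite (Nat.add_comm p' p) in B2.
  set (Z := (1 + x ^ 2) ^ (p + p')) in *.
  assert (0 < Z) by (apply pow_lt; lra).
  pose proof (Rle_abs K). pose proof (Rle_abs K').
  pose proof (pow_le (Rabs x) p (Rabs_pos x)).
    pose proof (pow_le (Rabs x) p' (Rabs_pos x)).
  assert (K * (1 + Rabs x ^ p) <= Rabs K * (2 * Z)).
  { apply Rle_trans with (Rabs K * (1 + Rabs x ^ p)); [apply Rmult_le_compat_r; lra|].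
    apply Rmult_le_compat_l; lra. }
  assert (K' * (1 + Rabs x ^ p') <= Rabs K' * (2 * Z)).
  { apply Rle_trans with (Rabs K' * (1 + Rabs x ^ p')); [apply Rmult_le_compat_r; lra|].
    apply Rmult_le_compat_l; lra. }
  pose proof (Rabs_triang (u t x) (- v t x)) as Tr. rewrite Rabs_Ropp in Tr.
  unfold Rminus. lra.
Qed.

Lemma bracketed_unique (sigma : R) (f : R -> R) (u : R -> R -> R) :
  0 <= sigma <= 1 -> bracketed sigma u ->
  continuous_on (fun p : R * R => 0 <= fst p) (uncurry2 u) ->
  (forall x, u 0 x = f x) -> polynomial_growth u ->
  unique_viscosity_solution sigma f u.
Proof.
  intros Hs br Cu Iu Gu. split.
  { split; [|exact Gu]. split; [exact Cu|split; [exact Iu|split]].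
    - now apply bracketed_subsolution.
    - now apply bracketed_supersolution. }
  intros v [Cv [Iv [Sub Sup]]] Gv t0 x0 Ht0.
  set (T := t0 + 1).
  apply Rle_antisym.
  - destruct (polynomial_growth_minus v u (T + 1) Gv Gu ltac:(unfold T;
      lra)) as [K [p [HK B]]].
    enough (v t0 x0 - u t0 x0 <= 0) by lra.
    apply (barrier_vanishes K T _ p t0 x0 (INR (S p) *
      (2 + 4 * INR p)) HK ltac:(unfold T; lra)).
    intros lambda HL Hl. apply Rnot_lt_le. intros Hpos.
    destruct (barrier_interior_max (fun t x => v t x - u t x) K lambda T p t0 x0)
      as [t [x [Ht L]]]; trivial.
    + now apply continuous_on_minus.
    + intros x. rewrite Iu, Iv. lra.
    + unfold T; lra.
    + destruct (br t x Ht) as [A [B' [CA [CB [EA [EB [LAB [SA SB]]]]]]]].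
      (* As u <= B' with equality at (t, x), the maximum of v - u - barrier is also a local maximum
         of v - (B' + barrier); the sum is a strict supersolution there. *)
      destruct (barrier_C12 K lambda T p) as [Cb _].
      destruct (C12_plus B' _ CB Cb) as [CP DP].
      destruct (DP t x Ht) as [D1 D2].
      pose proof (barrier_strict K lambda T p t x HK HL Ht) as BS.
      specialize (Sub _ t x CP Ht). rewrite D1, D2 in Sub.
      pose proof (G_plus_le sigma (dxx B' t x) (dxx
        (barrier K lambda T p) t x) Hs ltac:(lra)).
      assert (S : dt B' t x + dt (barrier K lambda T p) t x -
        G sigma (dxx B' t x + dxx (barrier K lambda T p) t x) <= 0); [|lra].
      apply Sub. generalize (filter_and _ _ L LAB). apply filter_imp. intros q [H1 H2].
        lra.
  - destruct (polynomial_growth_minus u v (T + 1) Gu Gv ltac:(unfold T;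
      lra)) as [K [p [HK B]]].
    enough (u t0 x0 - v t0 x0 <= 0) by lra.
    apply (barrier_vanishes K T _ p t0 x0 (INR (S p) *
      (2 + 4 * INR p)) HK ltac:(unfold T; lra)).
    intros lambda HL Hl. apply Rnot_lt_le. intros Hpos.
    destruct (barrier_interior_max (fun t x => u t x - v t x) K lambda T p t0 x0)
      as [t [x [Ht L]]]; trivial.
    + now apply continuous_on_minus.
    + intros x. rewrite Iu, Iv. lra.
    + unfold T; lra.
    + destruct (br t x Ht) as [A [B' [CA [CB [EA [EB [LAB [SA SB]]]]]]]].
      (* The test function is now A - barrier, written as a sum with the constant -K. *)
      destruct (barrier_C12 (- K) lambda T p) as [Cb Db].
      destruct (C12_plus A _ CA Cb) as [CP DP].
      destruct (DP t x Ht) as [D1 D2]. destruct (Db t x Ht) as [D3 D4].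
      destruct (proj2 (barrier_C12 K lambda T p) t x Ht) as [D5 D6].
      pose proof (barrier_strict K lambda T p t x HK HL Ht) as BS.
      assert (N : forall s y, barrier (- K) lambda T p s y = - barrier K lambda T p s y)
        by (intros; unfold barrier; ring).
      rewrite N in D3.
      assert (E3 : dt (barrier (- K) lambda T p) t x = - dt (barrier K lambda T p) t x)
        by lra.
      assert (E4 : dxx (barrier (- K) lambda T p) t x = - dxx (barrier K lambda T p) t x)
        by (rewrite D4, D6; ring).
      specialize (Sup _ t x CP Ht). rewrite D1, D2, E3, E4 in Sup.
      pose proof (G_plus_le sigma (dxx A t x + - dxx (barrier K lambda T p) t x) (dxx
        (barrier K lambda T p) t x) Hs ltac:(lra)) as GP.
      replace (dxx A t x + - dxx (barrier K lambda T p) t x + dxx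
        (barrier K lambda T p) t x) with (dxx A t x) in GP by ring.
      assert (S : 0 <= dt A t x + - dt (barrier K lambda T p) t x -
        G sigma (dxx A t x + - dxx (barrier K lambda T p) t x)); [|lra].
      apply Sup. generalize (filter_and _ _ L LAB). apply filter_imp. intros q [H1 H2].
      rewrite !N. lra.
Qed.

(** * Self-similar functions *)

(** Replaces the real power of t by an integer power of sqrt t, convenient for differentiation. *)
Definition scaled (n : nat) (P : R -> R) (t x : R) : R :=
  sqrt t ^ (2 * n + 1) * P (x / sqrt t).

Lemma self_similar_scaled (n : nat) (P : R -> R) (t x : R) : 0 < t ->
  self_similar n P t x = scaled n P t x.
Proof.
  intros Ht. unfold self_similar, scaled.
  destruct (Rlt_dec 0 t) as [_|H]; [|contradiction].
  rewrite Rpower_plus, Rpower_pow, Rpower_sqrt, pow_add, pow_mult by exact Ht.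
  rewrite pow2_sqrt by lra. now rewrite pow_1.
Qed.

Lemma G_scale (sigma s a : R) : 0 <= s -> G sigma (s * a) = s * G sigma a.
Proof.
  intros Hs. unfold G, neg_part, pos_part.
  rewrite Ropp_mult_distr_r.
  rewrite <- (Rmult_0_r s) at 1 2. rewrite !RmaxRmult by exact Hs. ring.
Qed.

Lemma continuous_scaled (c Q : R -> R) (t x : R) : 0 < t ->
  continuous c t -> (forall y, continuous Q y) ->
  continuous (uncurry2 (fun t x => c t * Q (x / sqrt t))) (t, x).
Proof.
  intros Ht Cc CQ. unfold uncurry2.
  apply (continuous_mult (K := R_AbsRing) (fun p : R * R => c (fst p))
           (fun p : R * R => Q (snd p / sqrt (fst p)))).
  - apply (continuous_comp (U := prod_UniformSpace R_UniformSpace R_UniformSpace) fst c);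
      [apply continuous_fst|exact Cc].
  - apply (continuous_comp (U := prod_UniformSpace R_UniformSpace R_UniformSpace)
             (fun p : R * R => snd p / sqrt (fst p)) Q); [|apply CQ].
    apply (continuous_mult (K := R_AbsRing) (fun p : R * R => snd p)
      (fun p : R * R => / sqrt (fst p)));
      [apply continuous_snd|].
    apply (continuous_comp (U := prod_UniformSpace R_UniformSpace R_UniformSpace) fst
      (fun t => / sqrt t));
      [apply continuous_fst|].
    apply (ex_derive_continuous (V := R_NormedModule)). simpl. auto_derive.
    split; [exact Ht|split; [|exact I]]. apply Rgt_not_eq, sqrt_lt_R0, Ht.
Qed.

Lemma scaled_C12 (n : nat) (a a1 a2 : R -> R) : C2 a a1 a2 ->
  C12 (scaled n a) /\
  forall t x, 0 < t ->
    let y := x / sqrt t in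
    let s := sqrt t ^ (2 * n + 1) / t in
    dt (scaled n a) t x = s * ((INR n + / 2) * a y - y / 2 * a1 y) /\
    dxx (scaled n a) t x = s * a2 y.
Proof.
  intros [D1 [D2 Ca2]].
  assert (Ca : forall y, continuous a y)
    by (intros y; apply (ex_derive_continuous (V := R_NormedModule)); eexists; apply D1).
  assert (Ca1 : forall y, continuous a1 y)
    by (intros y; apply (ex_derive_continuous (V := R_NormedModule)); eexists; apply D2).
  apply (C12_intro (scaled n a)
    (fun t x => sqrt t ^ (2 * n + 1) / t * ((INR n + / 2) * a
      (x / sqrt t) - x / sqrt t / 2 * a1 (x / sqrt t)))
    (fun t x => sqrt t ^ (2 * n) * a1 (x / sqrt t))
    (fun t x => sqrt t ^ (2 * n + 1) / t * a2 (x / sqrt t))).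
  intros t x Ht.
  pose proof (sqrt_lt_R0 t Ht) as Hr. pose proof (sqrt_sqrt t ltac:(lra)) as Hrr.
  assert (Dpow : forall k r, is_derive (fun r => r ^ k) r (INR k * r ^ pred k))
    by (intros; auto_derive; trivial; ring).
  assert (Dq : forall r, r <> 0 -> is_derive (fun r => x / r) r (- x / r ^ 2)).
  { intros r Hr0. auto_derive; trivial. field. exact Hr0. }
  assert (Cs : forall k, continuous (fun t => sqrt t ^ k) t).
  { intros k. apply (ex_derive_continuous (V := R_NormedModule)). auto_derive. lra. }
  assert (Cst : continuous (fun t => sqrt t ^ (2 * n + 1) / t) t).
  { apply (continuous_mult (K := R_AbsRing) (fun t => sqrt t ^ (2 * n + 1))
      (fun t => / t)); [apply Cs|].
    apply (ex_derive_continuous (V := R_NormedModule)). auto_derive. lra. }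
  assert (Dx : forall f f1, (forall y, is_derive f y (f1 y)) -> forall k,
    is_derive (fun x => sqrt t ^ k * f (x / sqrt t)) x (sqrt t ^ k * (/ sqrt t * f1
      (x / sqrt t)))).
  { intros f f1 Df k. apply is_derive_scal.
    apply (is_derive_comp (V := R_NormedModule) f (fun x => x / sqrt t)); [apply Df|].
    auto_derive; trivial. field. lra. }
  refine (conj _ (conj _ (conj _ (conj _ (conj _ (conj _ _)))))).
  (* The time derivative is computed in r = sqrt t, where the function is r^(2n+1) a(x/r), and then
     composed with sqrt. *)
  - eapply is_derive_eq.
    + apply (is_derive_comp (V := R_NormedModule) (fun r => r ^ (2 * n + 1) * a
        (x / r)) sqrt).
      * apply (is_derive_mult (fun r => r ^ (2 * n + 1)) (fun r => a (x / r)));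
          [apply Dpow| |intros; apply Rmult_comm].
        apply (is_derive_comp (V := R_NormedModule) a (fun r => x / r)); [apply D1|].
        apply Dq. lra.
      * apply (is_derive_eq _ _ (/ (2 * sqrt t))); [auto_derive; [exact Ht|field;
          lra]|reflexivity].
    + unfold scal, plus, mult; simpl; unfold mult; simpl.
      replace (pred (n + (n + 0) + 1)) with (2 * n)%nat by lia.
      replace (n + (n + 0) + 1)%nat with (S (2 * n)) by lia.
      rewrite S_INR, mult_INR. simpl (INR 2).
      rewrite <- tech_pow_Rmult.
      set (r := sqrt t) in *. set (p := r ^ (2 * n)).
      replace (/ t) with (/ (r * r)) by (now rewrite Hrr).
      unfold Rdiv. replace (/ t) with (/ (r * r)) by (now rewrite Hrr).
      field. lra.
  - eapply is_derive_eq; [apply (Dx a a1 D1)|].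
    rewrite pow_add. field. lra.
  - eapply is_derive_eq; [apply (Dx a1 a2 D2)|].
    rewrite pow_add. rewrite pow_1.
    transitivity (sqrt t ^ (2 * n) * sqrt t / (sqrt t * sqrt t) * a2 (x / sqrt t));
      [field; lra|now rewrite Hrr].
  - apply (continuous_scaled (fun t => sqrt t ^ (2 * n + 1)) a); auto.
  - apply (continuous_scaled (fun t => sqrt t ^ (2 * n + 1) / t) (fun y =>
      (INR n + / 2) * a y - y / 2 * a1 y)); auto.
    intros y. apply (ex_derive_continuous (V := R_NormedModule)).
    assert (ex_derive a y) by (eexists; apply D1). assert (ex_derive a1 y) by (eexists;
      apply D2).
    auto_derive; tauto.
  - apply (continuous_scaled (fun t => sqrt t ^ (2 * n)) a1); auto.
  - apply (continuous_scaled (fun t => sqrt t ^ (2 * n + 1) / t) a2); auto.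
Qed.

(** The one-variable counterpart of [bracketed] for (n + 1/2) P - y P'/2 = G(P''); homogeneity of G
    makes the two correspond under the scaling. *)
Definition profile_bracketed (n : nat) (sigma : R) (P : R -> R) (y : R) : Prop :=
  exists a a1 a2 b b1 b2 : R -> R,
    C2 a a1 a2 /\ C2 b b1 b2 /\ a y = P y /\ b y = P y /\
    locally y (fun z => a z <= P z <= b z) /\
    (INR n + / 2) * a y - y / 2 * a1 y <= G sigma (a2 y) /\
    G sigma (b2 y) <= (INR n + / 2) * b y - y / 2 * b1 y.

Lemma self_similar_bracketed (n : nat) (sigma : R) (P : R -> R) :
  (forall y, profile_bracketed n sigma P y) -> bracketed sigma (self_similar n P).
Proof.
  intros br t x Ht.
  destruct (br (x / sqrt t)) as [a [a1 [a2 [b [b1 [b2 [Ca [Cb [Ea [Eb [L [Sa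
    Sb]]]]]]]]]]]].
  destruct (scaled_C12 n a a1 a2 Ca) as [CA DA].
  destruct (scaled_C12 n b b1 b2 Cb) as [CB DB].
  destruct (DA t x Ht) as [DA1 DA2]. destruct (DB t x Ht) as [DB1 DB2].
  pose proof (sqrt_lt_R0 t Ht) as Hr.
  assert (Hs : 0 < sqrt t ^ (2 * n + 1) / t)
    by (apply Rdiv_lt_0_compat; [apply pow_lt, Hr|exact Ht]).
  exists (scaled n a), (scaled n b).
  refine (conj CA (conj CB (conj _ (conj _ (conj _ (conj _ _)))))).
  - rewrite self_similar_scaled by exact Ht. unfold scaled. now rewrite Ea.
  - rewrite self_similar_scaled by exact Ht. unfold scaled. now rewrite Eb.
  (* Continuity of (t, x) -> x / sqrt t pulls the neighbourhood of y back to one of (t, x). *)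
  - assert (C : continuous (uncurry2 (fun t x => 1 * (fun y => y) (x / sqrt t))) (t, x)).
    { apply (continuous_scaled (fun _ => 1) (fun y => y));
        [exact Ht|apply continuous_const|].
      intros; apply continuous_id. }
    unfold uncurry2 in C. simpl in C. unfold continuous in C. simpl in C.
      rewrite Rmult_1_l in C.
    specialize (C _ L). unfold filtermap in C.
    generalize (filter_and _ _ C (locally_fst_pos t x Ht)). apply filter_imp.
    intros [s z] [H Hpos]. simpl in *. rewrite Rmult_1_l in H.
    rewrite self_similar_scaled by exact Hpos. unfold scaled.
    pose proof (pow_lt (sqrt s) (2 * n + 1) (sqrt_lt_R0 s Hpos)).
    split; apply Rmult_le_compat_l; lra.
  - rewrite DA1, DA2, G_scale by lra. apply Rmult_le_compat_l; lra.
  - rewrite DB1, DB2, G_scale by lra. apply Rmult_le_compat_l; lra.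
Qed.

Lemma squeeze_continuous (u A B : R * R -> R) (D : R * R -> Prop) (p : R * R) :
  locally p (fun q => A q <= u q <= B q) -> A p = u p -> B p = u p ->
  continuous A p -> continuous B p -> filterlim u (within D (locally p)) (locally (u p)).
Proof.
  intros L EA EB CA CB.
  apply (filterlim_filter_le_1 (F := locally p)); [intros Q; unfold within;
    apply filter_imp; auto|].
  apply filterlim_locally. intros e.
  unfold continuous in CA, CB. rewrite EA in CA. rewrite EB in CB.
  apply filterlim_locally with (eps := e) in CA.
  apply filterlim_locally with (eps := e) in CB.
  generalize (filter_and _ _ L (filter_and _ _ CA CB)). unfold within. apply filter_imp.
  intros q [H [HA HB]].
  change (Rabs (A q - u p) < e) in HA. change (Rabs (B q - u p) < e) in HB.
  change (Rabs (u q - u p) < e).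
  apply Rabs_def2 in HA. apply Rabs_def2 in HB. apply Rabs_def1; lra.
Qed.

Section Growth.
Variables (n : nat) (P : R -> R) (K : R).
Hypothesis HP : forall y, Rabs (P y - y ^ (2 * n + 1)) <= K * (1 + Rabs y ^ (2 * n)).

(** The error allowed by [HP] is one degree below the leading term, so scaling leaves a factor sqrt
    t. This one estimate gives both continuity at t = 0 and polynomial growth. *)
Lemma self_similar_near_initial (t x : R) : 0 <= t ->
  Rabs (self_similar n P t x - x ^ (2 * n + 1))
  <= K * (sqrt t ^ (2 * n + 1) + sqrt t * Rabs x ^ (2 * n)).
Proof.
  intros [Ht| <-].
  - rewrite self_similar_scaled by exact Ht. unfold scaled.
    pose proof (sqrt_lt_R0 t Ht) as Hr. set (r := sqrt t) in *.
    specialize (HP (x / r)).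
    replace (r ^ (2 * n + 1) * P (x / r) - x ^ (2 * n + 1))
      with (r ^ (2 * n + 1) * (P (x / r) - (x / r) ^ (2 * n + 1))).
    + rewrite Rabs_mult, Rabs_pos_eq by (apply pow_le; lra).
      replace (K * (r ^ (2 * n + 1) + r * Rabs x ^ (2 * n)))
        with (r ^ (2 * n + 1) * (K * (1 + Rabs (x / r) ^ (2 * n)))).
      * apply Rmult_le_compat_l; [apply pow_le; lra|exact HP].
      * rewrite Rabs_div, (Rabs_pos_eq r) by lra. unfold Rdiv.
        rewrite Rpow_mult_distr, pow_inv, pow_add, pow_1. field. apply pow_nonzero. lra.
    + unfold Rdiv. rewrite Rpow_mult_distr, pow_inv. field. apply pow_nonzero. lra.
  - unfold self_similar. destruct (Rlt_dec 0 0) as [H|_]; [lra|].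
    unfold initial_value. rewrite Rminus_diag, Rabs_R0, sqrt_0.
    rewrite pow_i by lia. lra.
Qed.

Lemma self_similar_continuous_0 (x : R) :
  filterlim (uncurry2 (self_similar n P))
    (within (fun p : R * R => 0 <= fst p) (locally (0, x)))
    (locally (self_similar n P 0 x)).
Proof.
  apply filterlim_locally. intros e.
  assert (E0 : self_similar n P 0 x = x ^ (2 * n + 1)).
  { unfold self_similar. destruct (Rlt_dec 0 0) as [H|_]; [lra|reflexivity]. }
  rewrite E0.
  assert (He : 0 < e / 2) by (pose proof (cond_pos e); lra).
  pose (beta := fun p : R * R => K * (sqrt (fst p) ^ (2 * n + 1) + sqrt (fst p) * Rabs
    (snd p) ^ (2 * n))).
  assert (C1 : continuous (fun p : R * R => snd p ^ (2 * n + 1)) (0, x)).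
  { apply (continuous_comp (U := prod_UniformSpace R_UniformSpace R_UniformSpace) snd
      (fun y => y ^ (2 * n + 1)));
      [apply continuous_snd|].
    apply (ex_derive_continuous (V := R_NormedModule)). auto_derive; trivial. }
  assert (Cs : continuous (fun p : R * R => sqrt (fst p)) (0, x)).
  { apply (continuous_comp (U := prod_UniformSpace R_UniformSpace R_UniformSpace) fst
      sqrt);
      [apply continuous_fst|]. apply continuous_sqrt. }
  assert (Cpow : forall (f : R * R -> R) k, continuous f (0,
    x) -> continuous (fun p => f p ^ k) (0, x)).
  { intros f k Cf. apply (continuous_comp
      (U := prod_UniformSpace R_UniformSpace R_UniformSpace) f (fun y => y ^ k));
        [exact Cf|].
    apply (ex_derive_continuous (V := R_NormedModule)). auto_derive; trivial. }
  assert (C2 : continuous beta (0, x)).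
  { apply (continuous_scal_r (K := R_AbsRing) (V := R_NormedModule) K
      (fun p : R * R => sqrt (fst p) ^ (2 * n + 1) + sqrt (fst p) * Rabs (snd p) ^
        (2 * n))).
    apply (continuous_plus (V := R_NormedModule) (fun p : R * R => sqrt (fst p) ^
      (2 * n + 1)) (fun p : R * R => sqrt (fst p) * Rabs (snd p) ^ (2 * n))).
    - now apply Cpow.
    - apply (continuous_mult (K := R_AbsRing) (fun p : R * R => sqrt (fst p))
        (fun p : R * R => Rabs (snd p) ^ (2 * n))); [exact Cs|].
      apply Cpow. apply (continuous_comp
        (U := prod_UniformSpace R_UniformSpace R_UniformSpace) snd Rabs);
          [apply continuous_snd|apply continuous_Rabs]. }
  unfold continuous in C1, C2.
  apply filterlim_locally with (eps := mkposreal _ He) in C1.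
  apply filterlim_locally with (eps := mkposreal _ He) in C2.
  generalize (filter_and _ _ C1 C2). unfold within. apply filter_imp.
  intros [s y] [H1 H2] Hs. simpl in Hs.
  change (Rabs (y ^ (2 * n + 1) - x ^ (2 * n + 1)) < e / 2) in H1.
  change (Rabs (beta (s, y) - beta (0, x)) < e / 2) in H2.
  change (Rabs (self_similar n P s y - x ^ (2 * n + 1)) < e).
  pose proof (self_similar_near_initial s y Hs) as H3.
  change (Rabs (self_similar n P s y - y ^ (2 * n + 1)) <= beta (s, y)) in H3.
  assert (B0 : beta (0, x) = 0).
  { unfold beta. cbn [fst snd]. rewrite sqrt_0, pow_i by lia. ring. }
  rewrite B0, Rminus_0_r in H2. apply Rabs_def2 in H2.
  pose proof (Rabs_triang (self_similar n P s y - y ^ (2 * n + 1)) (y ^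
    (2 * n + 1) - x ^ (2 * n + 1))) as T.
  replace (self_similar n P s y - y ^ (2 * n + 1) + (y ^ (2 * n + 1) - x ^ (2 * n + 1)))
    with (self_similar n P s y - x ^ (2 * n + 1)) in T by ring.
  lra.
Qed.

Lemma self_similar_growth : polynomial_growth (self_similar n P).
Proof.
  intros T HT.
  assert (HK : 0 <= K).
  { pose proof (HP 0) as H. pose proof (Rabs_pos (P 0 - 0 ^ (2 * n + 1))).
    pose proof (pow_le (Rabs 0) (2 * n) (Rabs_pos 0)). nra. }
  exists (1 + K * (sqrt T ^ (2 * n + 1) + sqrt T)), (2 * n + 1)%nat.
  intros t x Ht.
  pose proof (self_similar_near_initial t x (proj1 Ht)) as H.
  pose proof (sqrt_pos t) as Hr. pose proof (sqrt_le_1_alt t T ltac:(lra)) as Hrt.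
  pose proof (pow_incr (sqrt t) (sqrt T) (2 * n + 1) (conj Hr Hrt)) as Hp.
  pose proof (Rabs_pos x) as Hx.
  pose proof (pow_le (Rabs x) (2 * n) Hx) as X1.
  assert (X2 : Rabs x ^ (2 * n) <= 1 + Rabs x ^ (2 * n + 1)).
  { rewrite pow_add, pow_1. destruct (Rle_dec (Rabs x) 1).
    - pose proof (pow_incr (Rabs x) 1 (2 * n) (conj Hx r)) as Q. rewrite pow1 in Q. nra.
    - nra. }
  pose proof (Rabs_triang_inv (self_similar n P t x) (x ^ (2 * n + 1))) as Tr.
  rewrite <- RPow_abs in Tr.
  set (a := sqrt T ^ (2 * n + 1)) in *. set (X := Rabs x ^ (2 * n + 1)) in *.
  assert (HX : 0 <= X) by (apply pow_le, Hx).
  assert (Ha : 0 <= a) by (apply pow_le, sqrt_pos).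
  assert (sqrt t * Rabs x ^ (2 * n) <= sqrt T * (1 + X)) by (apply Rmult_le_compat; lra).
  assert (K * (sqrt t ^ (2 * n + 1) + sqrt t * Rabs x ^ (2 * n)) <= K * (a + sqrt T *
    (1 + X)))
    by (apply Rmult_le_compat_l; lra).
  assert (0 <= K * a * X) by (repeat apply Rmult_le_pos; lra).
  lra.
Qed.

End Growth.

Theorem self_similar_unique (n : nat) (sigma : R) (P : R -> R) :
  0 <= sigma <= 1 ->
  (exists K, forall y, Rabs (P y - y ^ (2 * n + 1)) <= K * (1 + Rabs y ^ (2 * n))) ->
  (forall y, profile_bracketed n sigma P y) ->
  unique_viscosity_solution sigma (initial_value n) (self_similar n P).
Proof.
  intros Hs [K HK] br. pose proof (self_similar_bracketed n sigma P br) as brU.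
  apply bracketed_unique; trivial.
  - intros [t x] Ht. simpl in Ht. destruct Ht as [Ht| <-].
    + destruct (brU t x Ht) as [A [B [CA [CB [EA [EB [L _]]]]]]].
      apply (squeeze_continuous _ (uncurry2 A) (uncurry2 B)); trivial;
        [apply (CA t x Ht)|apply (CB t x Ht)].
    + now apply (self_similar_continuous_0 n P K).
  - intros x. unfold self_similar. destruct (Rlt_dec 0 0) as [H|_]; [lra|reflexivity].
  - now apply (self_similar_growth n P K).
Qed.

(** * The two branches of the profile *)

Definition glue (c : R) (r l : R -> R) (x : R) : R :=
  if Rle_dec c x then r x else l x.

Lemma glue_right (c : R) (r l : R -> R) (x : R) : c <= x -> glue c r l x = r x.
Proof. intros H. unfold glue. now destruct (Rle_dec c x). Qed.

Lemma glue_left (c : R) (r l : R -> R) (x : R) : x < c -> glue c r l x = l x.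
Proof. intros H. unfold glue. destruct (Rle_dec c x); [lra|reflexivity]. Qed.

Lemma locally_glue_right (c : R) (r l : R -> R) (x : R) : c < x ->
  locally x (fun y => glue c r l y = r y).
Proof.
  intros H. generalize (open_gt c x H). apply filter_imp.
  intros y Hy. apply glue_right. lra.
Qed.

Lemma locally_glue_left (c : R) (r l : R -> R) (x : R) : x < c ->
  locally x (fun y => glue c r l y = l y).
Proof.
  intros H. generalize (open_lt c x H). apply filter_imp.
  intros y Hy. now apply glue_left.
Qed.

Lemma glue_derive (c : R) (r r1 l l1 : R -> R) :
  (forall x, is_derive r x (r1 x)) -> (forall x, is_derive l x (l1 x)) ->
  r c = l c -> r1 c = l1 c -> forall x, is_derive (glue c r l) x (glue c r1 l1 x).
Proof.
  intros Dr Dl E E1 x. destruct (Rtotal_order c x) as [H|[<-|H]].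
  - rewrite glue_right by lra. apply (is_derive_ext_loc r); [|apply Dr].
    generalize (locally_glue_right c r l x H). now apply filter_imp.
  - rewrite glue_right by lra. apply is_derive_Reals. intros e He.
    destruct (proj1 (is_derive_Reals _ _ _) (Dr c) e He) as [d Hd].
    pose proof (Dl c) as Dlc. rewrite <- E1 in Dlc.
    destruct (proj1 (is_derive_Reals _ _ _) Dlc e He) as [d' Hd'].
    assert (P : 0 < Rmin d d') by (apply Rmin_glb_lt; apply cond_pos).
    exists (mkposreal _ P). intros s Hs Hsm. simpl in Hsm.
    pose proof (Rmin_l d d'). pose proof (Rmin_r d d').
    rewrite (glue_right c r l c) by lra.
    destruct (Rle_dec c (c + s)).
    + rewrite glue_right by assumption. apply Hd; [exact Hs|lra].
    + rewrite glue_left by lra. rewrite E. apply Hd'; [exact Hs|lra].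
  - rewrite glue_left by lra. apply (is_derive_ext_loc l); [|apply Dl].
    generalize (locally_glue_left c r l x H). now apply filter_imp.
Qed.

Lemma glue_continuous (c : R) (r l : R -> R) :
  (forall x, continuous r x) -> (forall x, continuous l x) -> r c = l c ->
  forall x, continuous (glue c r l) x.
Proof.
  intros Cr Cl E x. destruct (Rtotal_order c x) as [H|[<-|H]].
  - apply (continuous_ext_loc (T := R_UniformSpace) (U := R_UniformSpace)
      (glue c r l) r x); [|apply Cr].
    generalize (locally_glue_right c r l x H). now apply filter_imp.
  - pose proof (Cr c) as C1. pose proof (Cl c) as C2. unfold continuous in *.
    rewrite (glue_right c r l c) by lra. rewrite <- E in C2.
    apply filterlim_locally. intros e.
    apply filterlim_locally with (eps := e) in C1.
    apply filterlim_locally with (eps := e) in C2.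
    generalize (filter_and _ _ C1 C2). apply filter_imp.
    intros y [H1 H2]. unfold glue. now destruct (Rle_dec c y).
  - apply (continuous_ext_loc (T := R_UniformSpace) (U := R_UniformSpace)
      (glue c r l) l x); [|apply Cl].
    generalize (locally_glue_left c r l x H). now apply filter_imp.
Qed.

Lemma glue_C2 (c : R) (r r1 r2 l l1 l2 : R -> R) :
  C2 r r1 r2 -> C2 l l1 l2 -> r c = l c -> r1 c = l1 c -> r2 c = l2 c ->
  C2 (glue c r l) (glue c r1 l1) (glue c r2 l2).
Proof.
  intros [R1 [R2 R3]] [L1 [L2 L3]] E0 E1 E2. split; [|split].
  - now apply glue_derive.
  - now apply glue_derive.
  - now apply glue_continuous.
Qed.

Definition right_profile (n : nat) (k x : R) : R := g n x + k * hg n x.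
Definition right_profile1 (n : nat) (k x : R) : R := dg n x + k * dhg n x.
(** Read off the linear equation, in the shape of [C2_of_ode] with b = 1. *)
Definition right_profile2 (n : nat) (k x : R) : R :=
  (2 * INR n + 1) * right_profile n k x - 1 * x * right_profile1 n k x.

Lemma right_profile_C2 (n : nat) (k : R) : C2 (right_profile n k) (right_profile1 n k)
  (right_profile2 n k).
Proof.
  apply C2_of_ode; intros x.
  - apply (is_derive_plus (V := R_NormedModule) (g n)); [apply is_derive_g|].
    apply is_derive_scal, is_derive_hg.
  - eapply is_derive_eq.
    + apply (is_derive_plus (V := R_NormedModule) (dg n)); [apply is_derive_dg|].
      apply is_derive_scal, is_derive_dhg.
    + unfold plus, right_profile, right_profile1, ddhg; simpl. pose proof (g_ode n x).
      replace (ddg n x) with ((2 * INR n + 1) * g n x - x * dg n x) by lra. ring.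
Qed.

Lemma right_profile2_succ (n : nat) (k x : R) :
  right_profile2 (S n) k x = (2 * INR n + 3) * (2 * INR n + 2) * right_profile n k x.
Proof.
  unfold right_profile2, right_profile, right_profile1.
  pose proof (g_ode (S n) x) as E. rewrite ddg_g in E.
  pose proof (ddhg_succ n x) as E'. unfold ddhg in E'.
  rewrite S_INR in *.
  transitivity ((2 * INR n + 3) * (2 * INR n + 2) * g n x
    + k * ((2 * INR n + 3) * (2 * INR n + 2) * hg n x)); [rewrite <- E'; lra|ring].
Qed.

(** The bracket of the left branch is, by parity, [hg] at the reflected point; k stands for d_n /
    (2n)!!. *)
Definition left_profile (n : nat) (sigma k x : R) : R :=
  sigma ^ (2 * n + 1) * g n (x / sigma) + k * hg n (- (x / sigma)).
Definition left_profile1 (n : nat) (sigma k x : R) : R :=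
  sigma ^ (2 * n) * dg n (x / sigma) - k / sigma * dhg n (- (x / sigma)).
Definition left_profile2 (n : nat) (sigma k x : R) : R :=
  (2 * INR n + 1) / sigma ^ 2 * left_profile n sigma k x
  - / sigma ^ 2 * x * left_profile1 n sigma k x.

Lemma left_profile_C2 (n : nat) (sigma k : R) : 0 < sigma ->
  C2 (left_profile n sigma k) (left_profile1 n sigma k) (left_profile2 n sigma k).
Proof.
  intros Hs.
  assert (Dp : forall f f1, (forall y, is_derive f y (f1 y)) ->
    forall x, is_derive (fun x => f (x / sigma)) x (/ sigma * f1 (x / sigma))).
  { intros f f1 Df x. apply (is_derive_comp (V := R_NormedModule) f
      (fun x => x / sigma)); [apply Df|].
    auto_derive; trivial. field. lra. }
  assert (Dm : forall f f1, (forall y, is_derive f y (f1 y)) ->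
    forall x, is_derive (fun x => f (- (x / sigma))) x (- / sigma * f1 (- (x / sigma)))).
  { intros f f1 Df x. apply (is_derive_comp (V := R_NormedModule) f (fun x => -
      (x / sigma))); [apply Df|].
    auto_derive; trivial. field. lra. }
  apply C2_of_ode; intros x.
  - eapply is_derive_eq.
    + apply (is_derive_plus (V := R_NormedModule) (fun x => sigma ^ (2 * n + 1) * g n
        (x / sigma)));
        apply is_derive_scal.
      * apply (Dp _ _ (is_derive_g n)).
      * apply (Dm _ _ (is_derive_hg n)).
    + unfold plus, left_profile1; simpl (AbelianMonoid.plus _ _). rewrite pow_add.
        simpl. field. lra.
  - eapply is_derive_eq.
    + apply (is_derive_minus (V := R_NormedModule) (fun x => sigma ^ (2 * n) * dg n
        (x / sigma)));
        apply is_derive_scal.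
      * apply (Dp _ _ (is_derive_dg n)).
      * apply (Dm _ _ (is_derive_dhg n)).
    + unfold minus, plus, opp, left_profile, left_profile1, ddhg; simpl.
      pose proof (g_ode n (x / sigma)).
      replace (ddg n (x / sigma)) with ((2 * INR n + 1) * g n
        (x / sigma) - x / sigma * dg n (x / sigma)) by lra.
      replace (n + (n + 0) + 1)%nat with (S (n + (n + 0))) by lia.
      rewrite <- tech_pow_Rmult. field. lra.
Qed.

Lemma left_profile2_succ (n : nat) (sigma k x : R) : 0 < sigma ->
  left_profile2 (S n) sigma k x
  = (2 * INR n + 3) * (2 * INR n + 2) / sigma ^ 2
    * (sigma ^ (2 * n + 3) * g n (x / sigma) + k * hg n (- (x / sigma))).
Proof.
  intros Hs. unfold left_profile2, left_profile, left_profile1.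
  pose proof (g_ode (S n) (x / sigma)) as E. rewrite ddg_g in E.
  pose proof (ddhg_succ n (- (x / sigma))) as E'. unfold ddhg in E'.
  replace (2 * S n + 1)%nat with (S (2 * S n)) by lia.
  replace (2 * n + 3)%nat with (S (2 * S n)) by lia.
  rewrite <- !tech_pow_Rmult.
  set (p := sigma ^ (2 * S n)).
  rewrite S_INR in *.
  transitivity (/ sigma ^ 2 * (sigma * p * ((2 * INR n + 3) * (2 * INR n + 2) * g n
    (x / sigma))
    + k * ((2 * INR n + 3) * (2 * INR n + 2) * hg n (- (x / sigma))))).
  - rewrite <- E'.
    replace ((2 * INR n + 3) * (2 * INR n + 2) * g n (x / sigma))
      with ((2 * (INR n + 1) + 1) * g (S n) (x / sigma) - x / sigma * dg (S n)
        (x / sigma)) by lra.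
    field. lra.
  - field. lra.
Qed.

Lemma G_nonneg (sigma a : R) : 0 <= a -> G sigma a = a / 2.
Proof.
  intros H. unfold G, neg_part, pos_part.
  rewrite Rmax_right, Rmax_left by lra. lra.
Qed.

Lemma G_nonpos (sigma a : R) : a <= 0 -> G sigma a = sigma ^ 2 * a / 2.
Proof.
  intros H. unfold G, neg_part, pos_part.
  rewrite Rmax_left, Rmax_right by lra. lra.
Qed.

Section Interface.
Variables (m : nat) (c : R).
Hypothesis Hc : c < 0.
Let kr := - (g m c / hg m c).

Lemma right_profile_zero_at : right_profile m kr c = 0.
Proof. unfold right_profile, kr. pose proof (hg_pos m c). field. lra. Qed.

Lemma right_profile2_zero_at : right_profile2 (S m) kr c = 0.
Proof. rewrite right_profile2_succ, right_profile_zero_at. ring. Qed.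

(** In the recurrences for the slopes the terms with factor c add up to a multiple of g_m + kr H_m,
    which vanishes at c; the rest is the Wronskian over H_m. *)
Lemma right_profile1_at : right_profile1 (S m) kr c
  = (2 * INR m + 3) * INR (fact (2 * m + 1)) / mills m c.
Proof.
  unfold right_profile1. rewrite dg_succ, dhg_succ.
  pose proof (hg_pos m c). pose proof (gauss_pos c).
  transitivity ((2 * INR m + 3) * ((dg m c * hg m c - g m c * dhg m c) / hg m c)).
  - unfold kr. field. lra.
  - rewrite wronskian. unfold mills. field. lra.
Qed.

Lemma right_profile2_nonneg (x : R) : c <= x -> 0 <= right_profile2 (S m) kr x.
Proof.
  intros Hx. rewrite right_profile2_succ. pose proof (pos_INR m).
  apply Rmult_le_pos; [apply Rmult_le_pos; lra|].
  replace (right_profile m kr x) with (hg m x * (g m x / hg m x - g m c / hg m c)).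
  - apply Rmult_le_pos; [apply Rlt_le, hg_pos|].
    destruct Hx as [Hx| <-]; [|lra].
    pose proof (g_div_hg_increasing m c x Hx). lra.
  - unfold right_profile, kr. pose proof (hg_pos m x). pose proof (hg_pos m c).
    field. lra.
Qed.

Lemma right_profile_ode (k x : R) :
  (INR (S m) + / 2) * right_profile (S m) k x - x / 2 * right_profile1 (S m) k x
  = right_profile2 (S m) k x / 2.
Proof. unfold right_profile2. field. Qed.

Section Positive.
Variable sigma : R.
Hypothesis Hs : 0 < sigma.
Hypothesis balance : mills m (- (c / sigma)) = sigma ^ (2 * S m) * mills m c.
Let z := c / sigma.
Let kl := - (sigma ^ (2 * m + 3) * g m z / hg m (- z)).

Lemma left_profile2_zero_at : left_profile2 (S m) sigma kl c = 0.
Proof.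
  rewrite left_profile2_succ by exact Hs. unfold kl. fold z.
  pose proof (hg_pos m (- z)). field. lra.
Qed.

(** The Wronskian at -z gives the slope as a multiple of sigma^(2m+2) / [mills m (- z)], which
    [balance] identifies with 1 / [mills m c]. *)
Lemma left_profile1_at : left_profile1 (S m) sigma kl c
  = (2 * INR m + 3) * INR (fact (2 * m + 1)) / mills m c.
Proof.
  unfold left_profile1. rewrite dg_succ, dhg_succ. fold z.
  pose proof (hg_pos m (- z)). pose proof (gauss_pos z).
  pose proof (mills_pos m c).
  transitivity (sigma ^ (2 * S m) * ((2 * INR m + 3) *
    ((dg m (- z) * hg m (- z) - g m (- z) * dhg m (- z)) / hg m (- z)))).
  - unfold kl. rewrite dg_neg, g_neg.
    replace (2 * m + 3)%nat with (S (2 * S m)) by lia. rewrite <- tech_pow_Rmult.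
    field. lra.
  - rewrite wronskian, gauss_neg. fold z in balance.
    assert (E : sigma ^ (2 * S m) = mills m (- z) / mills m c)
      by (rewrite balance; field; lra).
    rewrite E. unfold mills at 1. rewrite gauss_neg. field. lra.
Qed.

(** For x < c < 0 one has g(x/sigma) < g(z) < 0 and 0 < H(-x/sigma) < H(-z), so g(x/sigma) H(-z)
    lies below g(z) H(-x/sigma). *)
Lemma left_profile2_nonpos (x : R) : x < c -> left_profile2 (S m) sigma kl x <= 0.
Proof.
  intros Hx. rewrite left_profile2_succ by exact Hs. pose proof (pos_INR m).
  pose proof (pow_lt sigma 2 Hs).
  assert (Hz : x / sigma < z)
    by (apply Rmult_lt_compat_r; [apply Rinv_0_lt_compat, Hs|exact Hx]).
  assert (Hz0 : z < 0).
  { unfold z, Rdiv. pose proof (Rinv_0_lt_compat sigma Hs). nra. }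
  pose proof (g_increasing m _ _ Hz).
  pose proof (g_negative m z Hz0).
  pose proof (hg_decreasing m (- z) (- (x / sigma)) ltac:(lra)).
  pose proof (hg_pos m (- z)). pose proof (hg_pos m (- (x / sigma))).
  pose proof (pow_lt sigma (2 * m + 3) Hs).
  assert (0 < (2 * INR m + 3) * (2 * INR m + 2) / sigma ^ 2)
    by (apply Rdiv_lt_0_compat; nra).
  enough (sigma ^ (2 * m + 3) * g m (x / sigma) + kl * hg m (- (x / sigma)) <= 0) by nra.
  replace (sigma ^ (2 * m + 3) * g m (x / sigma) + kl * hg m (- (x / sigma)))
    with (sigma ^ (2 * m + 3) * ((g m (x / sigma) * hg m (- z) - g m z * hg m (-
      (x / sigma))) / hg m (- z)))
    by (unfold kl; field; lra).
  assert (g m (x / sigma) * hg m (- z) - g m z * hg m (- (x / sigma)) <= 0) by nra.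
  assert ((g m (x / sigma) * hg m (- z) - g m z * hg m (- (x / sigma))) / hg m (- z) <= 0)
    by (apply Rle_div_l; lra).
  nra.
Qed.

(** The values at c match as a consequence of the rest: where the second derivative vanishes, both
    equations reduce to (2n+1) P = c P', and the slopes agree. *)
Lemma glued_profile_C2 :
  C2 (glue c (right_profile (S m) kr) (left_profile (S m) sigma kl))
     (glue c (right_profile1 (S m) kr) (left_profile1 (S m) sigma kl))
     (glue c (right_profile2 (S m) kr) (left_profile2 (S m) sigma kl)).
Proof.
  assert (E1 : right_profile1 (S m) kr c = left_profile1 (S m) sigma kl c)
    by (rewrite right_profile1_at, left_profile1_at; reflexivity).
  apply glue_C2; [apply right_profile_C2|apply left_profile_C2, Hs| |exact E1|].
  - pose proof right_profile2_zero_at as R0. pose proof left_profile2_zero_at as L0.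
    unfold right_profile2 in R0. unfold left_profile2 in L0. rewrite E1 in R0.
    pose proof (pos_INR (S m)). pose proof (pow_lt sigma 2 Hs).
    apply (Rmult_eq_reg_l (2 * INR (S m) + 1)); [|lra].
    transitivity (c * left_profile1 (S m) sigma kl c); [lra|].
    apply (Rmult_eq_reg_l (/ sigma ^ 2)); [|apply Rinv_neq_0_compat; lra].
    unfold Rdiv in L0. lra.
  - now rewrite right_profile2_zero_at, left_profile2_zero_at.
Qed.

Lemma glued_profile_bracketed (y : R) :
  profile_bracketed (S m) sigma (glue c (right_profile (S m) kr) (left_profile
    (S m) sigma kl)) y.
Proof.
  pose proof glued_profile_C2 as HC.
  do 3 eexists. do 3 eexists.
  refine (conj HC (conj HC (conj eq_refl (conj eq_refl (conj _ _))))).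
  - apply filter_forall. intros x. lra.
  - apply and_comm. apply Rle_le_eq. destruct (Rle_dec c y) as [H|H].
    + rewrite !glue_right by exact H.
      rewrite G_nonneg by now apply right_profile2_nonneg. symmetry.
        apply right_profile_ode.
    + rewrite !glue_left by lra.
      rewrite G_nonpos by (apply left_profile2_nonpos; lra).
      unfold left_profile2. field. lra.
Qed.

End Positive.
End Interface.

(** * Growth of the two branches *)

Lemma Rabs_pow_le (y : R) (j k : nat) : (j <= k)%nat ->
  Rabs y ^ j <= 1 + Rabs y ^ k.
Proof.
  intros H. pose proof (Rabs_pos y) as Hy.
  pose proof (pow_le (Rabs y) k Hy).
  destruct (Rle_dec (Rabs y) 1) as [H1|H1].
  - pose proof (pow_incr (Rabs y) 1 j (conj Hy H1)) as Q. rewrite pow1 in Q. lra.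
  - pose proof (Rle_pow (Rabs y) j k ltac:(lra) H). lra.
Qed.

Lemma g_leading_term (n : nat) : exists K, 0 <= K /\
  forall y, Rabs (g n y - y ^ (2 * n + 1)) <= K * (1 + Rabs y ^ (2 * n)).
Proof.
  destruct n as [|m].
  - exists 0. split; [lra|]. intros y. rewrite g_coef. cbn [sum_f_R0].
    rewrite gcoef_diag. rewrite Rmult_1_l, Rminus_diag, Rabs_R0. lra.
  - assert (B : forall N, (N <= m)%nat -> exists K, 0 <= K /\ forall y,
      Rabs (sum_f_R0 (fun i => gcoef (S m) i * y ^ (2 * i + 1)) N) <= K * (1 + Rabs y ^
        (2 * S m))).
    { assert (T : forall i y, (i <= m)%nat -> Rabs (gcoef (S m) i * y ^
        (2 * i + 1)) <= gcoef (S m) i * (1 + Rabs y ^ (2 * S m))).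
      { intros i y Hi. pose proof (gcoef_pos (S m) i).
        rewrite Rabs_mult, <- RPow_abs, (Rabs_pos_eq (gcoef _ _)) by lra.
        apply Rmult_le_compat_l; [lra|]. apply Rabs_pow_le. lia. }
      induction N as [|N IH]; intros HN.
      - exists (gcoef (S m) 0). split; [apply Rlt_le, gcoef_pos|].
        intros y. now apply T.
      - destruct IH as [K [HK B]]; [lia|].
        exists (K + gcoef (S m) (S N)). pose proof (gcoef_pos (S m) (S N)).
        split; [lra|]. intros y. rewrite tech5.
        eapply Rle_trans; [apply Rabs_triang|]. rewrite Rmult_plus_distr_r.
        apply Rplus_le_compat; [apply B|apply T; lia]. }
    destruct (B m (le_n m)) as [K [HK BK]]. exists K. split; [exact HK|].
    intros y. rewrite g_coef, tech5, gcoef_diag, Rmult_1_l.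
    match goal with |- Rabs (?s + ?t - ?t) <= _ => replace (s + t - t) with s by ring end.
    apply BK.
Qed.

Lemma right_profile_growth (n : nat) (k c : R) : exists K, 0 <= K /\ forall y, c <= y ->
  Rabs (right_profile n k y - y ^ (2 * n + 1)) <= K * (1 + Rabs y ^ (2 * n)).
Proof.
  destruct (g_leading_term n) as [K [HK B]].
  pose proof (hg_pos n c). pose proof (Rabs_pos k).
  exists (K + Rabs k * hg n c). split; [nra|]. intros y Hy. unfold right_profile.
  replace (g n y + k * hg n y - y ^ (2 * n + 1))
    with ((g n y - y ^ (2 * n + 1)) + k * hg n y) by ring.
  eapply Rle_trans; [apply Rabs_triang|]. specialize (B y).
  rewrite (Rabs_mult k), (Rabs_pos_eq (hg n y)) by apply Rlt_le, hg_pos.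
  assert (hg n y <= hg n c).
  { destruct Hy as [Hy| ->]; [apply Rlt_le, hg_decreasing, Hy|lra]. }
  pose proof (pow_le (Rabs y) (2 * n) (Rabs_pos y)).
  assert (Rabs k * hg n y <= Rabs k * hg n c) by (apply Rmult_le_compat_l; lra).
  assert (0 <= Rabs k * hg n c) by nra.
  nra.
Qed.

(** The left branch is -sigma^(2n+1) times a right branch evaluated at -y/sigma, so the bound is
    inherited from the right one. *)
Lemma left_profile_growth (n : nat) (sigma k c : R) : 0 < sigma <= 1 ->
  exists K, 0 <= K /\ forall y, y < c ->
  Rabs (left_profile n sigma k y - y ^ (2 * n + 1)) <= K * (1 + Rabs y ^ (2 * n)).
Proof.
  intros Hs.
  destruct (right_profile_growth n (- (k / sigma ^ (2 * n + 1))) (-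
    (c / sigma))) as [K [HK B]].
  exists K. split; [exact HK|]. intros y Hy.
  assert (Hz : y / sigma < c / sigma)
    by (apply Rmult_lt_compat_r; [apply Rinv_0_lt_compat; lra|exact Hy]).
  specialize (B (- (y / sigma)) ltac:(lra)).
  pose proof (pow_lt sigma (2 * n) ltac:(lra)) as Hp.
  pose proof (pow_incr sigma 1 (2 * n) ltac:(lra)) as Hp1. rewrite pow1 in Hp1.
  assert (E : left_profile n sigma k y - y ^ (2 * n + 1)
    = - (sigma ^ (2 * n + 1) * (right_profile n (- (k / sigma ^ (2 * n + 1))) (-
      (y / sigma)) - (- (y / sigma)) ^ (2 * n + 1)))).
  { unfold left_profile, right_profile. rewrite g_neg.
    replace ((- (y / sigma)) ^ (2 * n + 1)) with (- (y ^ (2 * n + 1) / sigma ^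
      (2 * n + 1))).
    - field. apply pow_nonzero. lra.
    - replace (- (y / sigma)) with (-1 * (y * / sigma)) by (unfold Rdiv; ring).
      rewrite !Rpow_mult_distr, pow_inv, (pow_add (-1)), pow_1_even. unfold Rdiv. ring. }
  rewrite E, Rabs_Ropp, Rabs_mult, Rabs_pos_eq by (apply pow_le; lra).
  assert (E2 : sigma ^ (2 * n) * Rabs (- (y / sigma)) ^ (2 * n) = Rabs y ^ (2 * n)).
  { rewrite Rabs_Ropp, Rabs_div, (Rabs_pos_eq sigma) by lra. unfold Rdiv.
    rewrite Rpow_mult_distr, pow_inv. field. lra. }
  set (w := Rabs (- (y / sigma)) ^ (2 * n)) in *.
  assert (0 <= w) by (apply pow_le, Rabs_pos).
  apply Rle_trans with (sigma ^ (2 * n + 1) * (K * (1 + w)));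
    [apply Rmult_le_compat_l; [apply pow_le; lra|exact B]|].
  rewrite pow_add, pow_1.
  rewrite <- E2.
  replace (sigma ^ (2 * n) * sigma * (K * (1 + w))) with (K * (sigma * (sigma ^
    (2 * n) + sigma ^ (2 * n) * w))) by ring.
  apply Rmult_le_compat_l; [exact HK|].
  assert (0 <= sigma ^ (2 * n) * w) by nra. nra.
Qed.

(** * The stated constants and the case of positive sigma *)

Lemma P_right_right_profile (n : nat) (k x : R) :
  P_right n k x = right_profile n (k / INR (double_fact (2 * n))) x.
Proof. reflexivity. Qed.

Lemma P_pos_glue (n : nat) (sigma c k d x : R) : 0 < sigma ->
  P_pos n sigma c k d x
  = glue c (right_profile n (k / INR (double_fact (2 * n))))
      (left_profile n sigma (d / INR (double_fact (2 * n)))) x.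
Proof.
  intros Hs. unfold P_pos, glue. destruct (Rle_dec c x); [apply P_right_right_profile|].
  unfold left_profile, hg. rewrite h_neg, g_neg, gauss_neg, lower_gauss_upper.
  unfold gauss. replace (- x ^ 2 / (2 * sigma ^ 2)) with (- (x / sigma) ^ 2 / 2)
    by (field; lra).
  ring.
Qed.

Lemma double_fact_fact (k : nat) :
  (double_fact (S k) * double_fact k)%nat = fact (S k).
Proof.
  induction k as [|k IH]; [reflexivity|].
  change (double_fact (S (S k))) with (S (S k) * double_fact k)%nat.
  rewrite (fact_simpl (S k)), <- IH. lia.
Qed.

Lemma double_fact_pos (k : nat) : 0 < INR (double_fact k).
Proof.
  apply lt_0_INR. pose proof (double_fact_fact k). pose proof (lt_O_fact (S k)).
  destruct (double_fact k); lia.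
Qed.

Lemma constants_pos_exist (m : nat) (sigma : R) : 0 < sigma < 1 ->
  exists c k d, constants_pos (S m) sigma c k d.
Proof.
  intros Hs. destruct (mills_balance m (2 * S m) sigma Hs ltac:(lia)) as [a [Ha E]].
  exists (- a). do 2 eexists. split; [lra|].
  replace (S m - 1)%nat with m by lia.
  split; [|split; reflexivity].
  replace ((- a) ^ 2 / (2 * sigma ^ 2)) with ((- a / sigma) ^ 2 / 2) by (field; lra).
  rewrite mills_lower, mills_upper, <- E. f_equal. field. lra.
Qed.

(** The exponential in d is a quotient of Gaussian values; with the equation for c it turns d /
    (2n)!! into the coefficient for which the second derivative of the left branch vanishes at c. *)
Lemma constants_pos_spec (m : nat) (sigma c k d : R) : 0 < sigma ->
  constants_pos (S m) sigma c k d ->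
  c < 0 /\ mills m (- (c / sigma)) = sigma ^ (2 * S m) * mills m c /\
  k / INR (double_fact (2 * S m)) = - (g m c / hg m c) /\
  d / INR (double_fact (2 * S m))
  = - (sigma ^ (2 * m + 3) * g m (c / sigma) / hg m (- (c / sigma))).
Proof.
  intros Hs. unfold constants_pos. replace (S m - 1)%nat with m by lia.
  fold (gauss c). fold (hg m c).
  replace (c ^ 2 / (2 * sigma ^ 2)) with ((c / sigma) ^ 2 / 2) by (field; lra).
  rewrite mills_lower, mills_upper.
  intros [Hc [E [Ek Ed]]]. split; [exact Hc|split; [exact E|]].
  pose proof (double_fact_pos (2 * S m)). pose proof (hg_pos m c).
  pose proof (hg_pos m (- (c / sigma))). pose proof (gauss_pos c).
  pose proof (gauss_pos (c / sigma)). pose proof (g_negative m c Hc).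
  assert (Ek' : k / INR (double_fact (2 * S m)) = - (g m c / hg m c))
    by (rewrite Ek; field; lra).
  split; [exact Ek'|].
  assert (X : exp ((1 - sigma ^ 2) / (2 * sigma ^ 2) * c ^ 2) = gauss c / gauss
    (c / sigma)).
  { unfold gauss, Rdiv. rewrite <- exp_Ropp, <- exp_plus. f_equal. field. lra. }
  rewrite X in Ed.
  replace (d / INR (double_fact (2 * S m)))
    with (sigma * g m (c / sigma) / g m c * (k / INR (double_fact (2 * S m))) *
      (gauss c / gauss (c / sigma)))
    by (rewrite Ed; field; lra).
  rewrite Ek'. replace (2 * m + 3)%nat with (S (2 * S m)) by lia.
    rewrite <- tech_pow_Rmult.
  pose proof (mills_pos m c).
  assert (E' : sigma ^ (2 * S m) = mills m (- (c / sigma)) / mills m c) by (rewrite E;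
    field; lra).
  rewrite E'. unfold mills. rewrite gauss_neg. field. lra.
Qed.

Lemma P_pos_unique (m : nat) (sigma c k d : R) : 0 < sigma < 1 ->
  constants_pos (S m) sigma c k d ->
  unique_viscosity_solution sigma (initial_value (S m))
    (self_similar (S m) (P_pos (S m) sigma c k d)).
Proof.
  intros Hs Hcst.
  destruct (constants_pos_spec m sigma c k d ltac:(lra) Hcst) as [Hc [E [Ek Ed]]].
  assert (EP : forall x, P_pos (S m) sigma c k d x =
    glue c (right_profile (S m) (- (g m c / hg m c)))
      (left_profile (S m) sigma (- (sigma ^ (2 * m + 3) * g m (c / sigma) / hg m (-
        (c / sigma))))) x).
  { intros x. rewrite P_pos_glue, Ek, Ed by lra. reflexivity. }
  apply self_similar_unique; [lra| |].
  - destruct (right_profile_growth (S m) (- (g m c / hg m c)) c) as [K [HK B]].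
    destruct (left_profile_growth (S m) sigma (- (sigma ^ (2 * m + 3) * g m
      (c / sigma) / hg m (- (c / sigma)))) c ltac:(lra)) as [K' [HK' B']].
    exists (K + K'). intros y. rewrite EP.
    pose proof (pow_le (Rabs y) (2 * S m) (Rabs_pos y)) as Hp.
    set (w := Rabs y ^ (2 * S m)) in *.
    destruct (Rle_dec c y) as [H|H].
    + rewrite glue_right by exact H. specialize (B y H). fold w in B. nra.
    + rewrite glue_left by lra. specialize (B' y ltac:(lra)). fold w in B'. nra.
  - intros y.
    destruct (glued_profile_bracketed m c Hc sigma ltac:(lra) E y)
      as [a [a1 [a2 [b [b1 [b2 [Ca [Cb [Ea [Eb [L R]]]]]]]]]]].
    exists a, a1, a2, b, b1, b2. rewrite EP.
    refine (conj Ca (conj Cb (conj Ea (conj Eb (conj _ R))))).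
    revert L. apply filter_imp. intros x. now rewrite EP.
Qed.

(** * The degenerate case sigma = 0 *)

Lemma C2_local_min (D D1 D2 : R -> R) (c : R) : C2 D D1 D2 ->
  D c = 0 -> D1 c = 0 -> 0 < D2 c -> locally c (fun y => 0 <= D y).
Proof.
  intros [HD [HD1 CD2]] E0 E1 P.
  pose proof (CD2 c (fun z => 0 < z) (open_gt 0 _ P)) as [e He].
  assert (He' : forall y, c - e < y < c + e -> 0 < D2 y).
  { intros y Hy. apply He. apply Rabs_def1; unfold minus, plus, opp; simpl; lra. }
  exists e. intros y Hy. change (Rabs (y - c) < e) in Hy. apply Rabs_def2 in Hy.
  destruct (Rtotal_order c y) as [H|[<-|H]]; [|lra|].
  - destruct (MVT_cor2 D D1 c y H) as [a [Ea Ha]]; [intros; apply is_derive_Reals, HD|].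
    destruct (MVT_cor2 D1 D2 c a (proj1 Ha)) as [b [Eb Hb]]; [intros;
      apply is_derive_Reals, HD1|].
    pose proof (He' b ltac:(lra)). rewrite E1, Rminus_0_r in Eb.
    assert (0 < D1 a) by (rewrite Eb; apply Rmult_lt_0_compat; lra).
    rewrite E0, Rminus_0_r in Ea. rewrite Ea. apply Rmult_le_pos; lra.
  - destruct (MVT_cor2 D D1 y c H) as [a [Ea Ha]]; [intros; apply is_derive_Reals, HD|].
    destruct (MVT_cor2 D1 D2 a c (proj2 Ha)) as [b [Eb Hb]]; [intros;
      apply is_derive_Reals, HD1|].
    pose proof (He' b ltac:(lra)).
    assert (0 < D2 b * (c - a)) by (apply Rmult_lt_0_compat; lra).
    assert (0 <= (- D1 a) * (c - y)) by (apply Rmult_le_pos; lra).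
    lra.
Qed.

Lemma C2_minus (a a1 a2 b b1 b2 : R -> R) : C2 a a1 a2 -> C2 b b1 b2 ->
  C2 (fun x => a x - b x) (fun x => a1 x - b1 x) (fun x => a2 x - b2 x).
Proof.
  intros [A1 [A2 A3]] [B1 [B2 B3]]. split; [|split]; intros x.
  - now apply (is_derive_minus (V := R_NormedModule) a b).
  - now apply (is_derive_minus (V := R_NormedModule) a1 b1).
  - now apply (continuous_minus (V := R_NormedModule) a2 b2).
Qed.

Lemma pow_C2 (k : nat) :
  C2 (fun x => x ^ k) (fun x => INR k * x ^ (k - 1))
     (fun x => INR k * INR (k - 1) * x ^ (k - 2)).
Proof.
  assert (Dpow : forall k x, is_derive (fun x => x ^ k) x (INR k * x ^ (k - 1))).
  { intros j x. replace (j - 1)%nat with (pred j) by lia. auto_derive; trivial; ring. }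
  split; [exact (Dpow k)|split; intros x].
  - rewrite Rmult_assoc. apply is_derive_scal.
    replace (k - 2)%nat with (k - 1 - 1)%nat by lia. apply Dpow.
  - apply (ex_derive_continuous (V := R_NormedModule)). auto_derive; trivial.
Qed.

Lemma pow_odd_neg (j : nat) (y : R) : y < 0 -> y ^ (2 * j + 1) < 0.
Proof.
  intros Hy. rewrite pow_add, pow_mult, pow_1.
  assert (0 < (y ^ 2) ^ j) by (apply pow_lt; simpl; nra). nra.
Qed.

Lemma constants_zero_exist (m : nat) : exists c k, constants_zero (S m) c k.
Proof.
  destruct (mills_attains m (2 * S m) (INR (fact (2 * S m - 1)))
    (INR_fact_lt_0 _) ltac:(lia)) as [a [Ha E]].
  exists (- a). eexists. split; [lra|]. split; [|reflexivity].
  replace (S m - 1)%nat with m by lia.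
  rewrite mills_upper, E, !pow_mult. f_equal. f_equal. ring.
Qed.

(** The stated k has a different form, but (2n)!! (2n-1)!! = (2n)! and the equation for c reduce it
    to the same coefficient as for sigma > 0. *)
Lemma constants_zero_spec (m : nat) (c k : R) : constants_zero (S m) c k ->
  c < 0 /\ INR (fact (2 * m + 1)) = c ^ (2 * S m) * mills m c /\
  k / INR (double_fact (2 * S m)) = - (g m c / hg m c).
Proof.
  unfold constants_zero. replace (S m - 1)%nat with m by lia.
  rewrite mills_upper, exp_sq_gauss.
  replace (2 * S m - 1)%nat with (2 * m + 1)%nat by lia.
  intros [Hc [E Ek]]. split; [exact Hc|split; [exact E|]].
  pose proof (double_fact_pos (2 * S m)). pose proof (double_fact_pos (2 * m + 1)).
  pose proof (hg_pos m c). pose proof (gauss_pos c). pose proof (mills_pos m c).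
  pose proof (INR_fact_lt_0 (2 * m + 1)).
  assert (P : INR (double_fact (2 * S m)) = 2 * INR (S m) * INR (fact (2 * m + 1)) / INR
    (double_fact (2 * m + 1))).
  { pose proof (double_fact_fact (2 * m + 1)) as Q. apply (f_equal INR) in Q.
    rewrite mult_INR, INR_fact_S in Q.
    replace (2 * S m)%nat with (S (2 * m + 1)) by lia.
    rewrite S_INR. rewrite plus_INR, mult_INR in Q. simpl (INR 2) in Q.
      simpl (INR 1) in Q.
    replace (2 * (INR m + 1)) with ((1 + 1) * INR m + 1 + 1) by ring.
    rewrite <- Q. field. lra. }
  pose proof (lt_0_INR (S m) ltac:(lia)).
  assert (E' : c ^ (2 * S m) = INR (fact (2 * m + 1)) / mills m c) by (rewrite E; field;
    lra).
  rewrite Ek, P, E'. unfold mills. field. lra.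
Qed.

Lemma P_zero_unique (m : nat) (c k : R) : constants_zero (S m) c k ->
  unique_viscosity_solution 0 (initial_value (S m))
    (self_similar (S m) (P_zero (S m) c k)).
Proof.
  intros Hcst. destruct (constants_zero_spec m c k Hcst) as [Hc [E Ek]].
  set (kr := - (g m c / hg m c)) in *.
  set (r := right_profile (S m) kr). set (p := fun x : R => x ^ (2 * S m + 1)).
  assert (EP : forall x, P_zero (S m) c k x = glue c r p x).
  { intros x. unfold P_zero, glue, r. rewrite P_right_right_profile, Ek. reflexivity. }
  pose proof (right_profile_C2 (S m) kr) as Cr. fold r in Cr.
  pose proof (pow_C2 (2 * S m + 1)) as Cp. fold p in Cp.
  set (p1 := fun x => INR (2 * S m + 1) * x ^ (2 * S m + 1 - 1)) in Cp.
  set (p2 := fun x => INR (2 * S m + 1) * INR (2 * S m + 1 - 1) * x ^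
    (2 * S m + 1 - 2)) in Cp.
  assert (Hn : INR (2 * S m + 1) = 2 * INR (S m) + 1)
    by (rewrite plus_INR, mult_INR; simpl (INR 2); simpl (INR 1); ring).
  assert (Hp2 : forall x, x < 0 -> p2 x < 0).
  { intros x Hx. unfold p2. replace (2 * S m + 1 - 2)%nat with (2 * m + 1)%nat by lia.
    pose proof (pow_odd_neg m x Hx).
    pose proof (lt_0_INR (2 * S m + 1) ltac:(lia)).
    pose proof (lt_0_INR (2 * S m + 1 - 1) ltac:(lia)).
    assert (0 < INR (2 * S m + 1) * INR (2 * S m + 1 - 1))
      by (now apply Rmult_lt_0_compat).
    nra. }
  (* For sigma = 0 the equation on the concave side is of first order, and x^(2n+1) solves it
     exactly. *)
  assert (Op : forall x, (INR (S m) + / 2) * p x - x / 2 * p1 x = 0).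
  { intros x. unfold p, p1. rewrite Hn.
      replace (2 * S m + 1 - 1)%nat with (2 * S m)%nat by lia.
    rewrite pow_add. field. }
  assert (R1 : right_profile1 (S m) kr c = p1 c).
  { unfold kr, p1. rewrite right_profile1_at, E, Hn, S_INR.
    replace (2 * S m + 1 - 1)%nat with (2 * S m)%nat by lia.
    pose proof (mills_pos m c). field. lra. }
  assert (R2 : right_profile2 (S m) kr c = 0) by apply right_profile2_zero_at.
  assert (R0 : r c = p c).
  { pose proof (right_profile_ode m kr c) as O. rewrite R1, R2 in O. fold r in O.
    pose proof (Op c). pose proof (pos_INR (S m)).
    apply (Rmult_eq_reg_l (INR (S m) + / 2)); lra. }
  (* At c the difference r - p has zero value and slope, and its second derivative is -p''(c) > 0
     because c < 0. *)
  assert (Loc : locally c (fun y => p y <= r y)).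
  { assert (L : locally c (fun y => 0 <= r y - p y)).
    { apply (C2_local_min _ _ _ c (C2_minus _ _ _ _ _ _ Cr Cp)); [lra|lra|].
      rewrite R2. specialize (Hp2 c Hc). lra. }
    revert L. apply filter_imp. intros y. lra. }
  apply self_similar_unique; [lra| |].
  - destruct (right_profile_growth (S m) kr c) as [K [HK B]].
    exists K. intros y. rewrite EP.
    pose proof (pow_le (Rabs y) (2 * S m) (Rabs_pos y)) as Hp.
    set (w := Rabs y ^ (2 * S m)) in *.
    destruct (Rle_dec c y) as [H|H].
    + rewrite glue_right by exact H. now apply B.
    + rewrite glue_left by lra. unfold p. rewrite Rminus_diag, Rabs_R0. nra.
  - intros y. unfold profile_bracketed. rewrite EP.
    assert (Gr : c <= y -> G 0 (right_profile2 (S m) kr y) = (INR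
      (S m) + / 2) * r y - y / 2 * right_profile1 (S m) kr y).
    { intros H. rewrite G_nonneg by now apply right_profile2_nonneg. symmetry.
        apply right_profile_ode. }
    assert (Gp : y <= c -> G 0 (p2 y) = (INR (S m) + / 2) * p y - y / 2 * p1 y).
    { intros H. rewrite Op, G_nonpos; [simpl; field|]. apply Rlt_le, Hp2. lra. }
    destruct (Rtotal_order c y) as [H|[<-|H]].
    + exists r, (right_profile1 (S m) kr), (right_profile2 (S m) kr), r,
        (right_profile1 (S m) kr), (right_profile2 (S m) kr).
      rewrite glue_right, Gr by lra.
      refine (conj Cr (conj Cr (conj eq_refl (conj eq_refl (conj _ (conj (Rle_refl _)
        (Rle_refl _))))))).
      generalize (locally_glue_right c r p y H). apply filter_imp. intros x Hx.
        rewrite EP, Hx. lra.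
    + exists p, p1, p2, r, (right_profile1 (S m) kr), (right_profile2 (S m) kr).
      rewrite glue_right, Gr, Gp by lra.
      refine (conj Cp (conj Cr (conj (eq_sym R0) (conj eq_refl (conj _ (conj
        (Rle_refl _) (Rle_refl _))))))).
      revert Loc. apply filter_imp. intros x Hx. rewrite EP. unfold glue.
      destruct (Rle_dec c x); lra.
    + exists p, p1, p2, p, p1, p2.
      rewrite glue_left, Gp by lra.
      refine (conj Cp (conj Cp (conj eq_refl (conj eq_refl (conj _ (conj (Rle_refl _)
        (Rle_refl _))))))).
      generalize (locally_glue_left c r p y H). apply filter_imp. intros x Hx.
        rewrite EP, Hx. lra.
Qed.

Theorem theorem5 (n : nat) (hn : (1 <= n)%nat) :
  (forall sigma : R, 0 < sigma < 1 ->
     (exists c k d : R, constants_pos n sigma c k d) /\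
     (forall c k d : R, constants_pos n sigma c k d ->
        unique_viscosity_solution sigma (initial_value n)
          (self_similar n (P_pos n sigma c k d)))) /\
  ((exists c k : R, constants_zero n c k) /\
   (forall c k : R, constants_zero n c k ->
      unique_viscosity_solution 0 (initial_value n)
        (self_similar n (P_zero n c k)))).
Proof.
  destruct n as [|m]; [lia|]. split; [|split].
  - intros sigma Hs. split; [now apply constants_pos_exist|].
    intros c k d. now apply P_pos_unique.
  - apply constants_zero_exist.
  - intros c k. apply P_zero_unique.
Qed.
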